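(* Let $D\ge 1$ and $r\ge 3$ be integers. For the Hamming graph $H(D,r)$, let $W$ denote an irreducible $\mathbb{T}$-module with diameter $d$. Then the action of $\mathbb{A}_{D}^{-1}\mathbb{A}_{D}^{*-1}\mathbb{A}_{D}\mathbb{A}_{D}^{*}$ on $W$ is diagonalizable with eigenvalues $(1-r)^s$, where $-d \leq s \leq d$ and $d-s$ is even. The corresponding eigenspaces all have dimension $1$.
   Context: Let $X$ be a set with $|X|=r$. The Hamming graph $H(D,r)$ has vertex set $\mathbb{X}=X\times\cdots\times X$ ($D$ factors), with two vertices adjacent whenever they differ in precisely one coordinate; it is distance-regular with diameter $D$. Let $\partial$ denote its path-length distance, and let $\mathbb{V}=\mathbb{C}^{\mathbb{X}}$. Matrices are complex, with rows and columns indexed by $\mathbb{X}$, and act on $\mathbb{V}$ by left multiplication. For $0\le i\le D$ the $i$th distance matrix $\mathbb{A}_i$ has $(y,z)$-entry $1$ if $\partial(y,z)=i$ and $0$ otherwise. The primitive idempotents $\mathbb{E}_0,\ldots,\mathbb{E}_D$ are taken in the standard $Q$-polynomial ordering: $\mathbb{E}_i$ is the matrix of the orthogonal projection of $\mathbb{V}$ onto the eigenspace of $\mathbb{A}_1$ with eigenvalue $(r-1)D-ri$. Fix $x\in X$ and let $\mathbf{x}=(x,x,\ldots,x)\in\mathbb{X}$. For $0\le i\le D$, the $i$th dual idempotent $\mathbb{E}_i^*$ is the diagonal matrix with $(y,y)$-entry $1$ if $\partial(\mathbf{x},y)=i$ and $0$ otherwise, and the $i$th dual distance matrix $\mathbb{A}_i^*$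 is the diagonal matrix with $(y,y)$-entry $r^D(\mathbb{E}_i)_{\mathbf{x}y}$. It is known that $\mathbb{A}_D$ and $\mathbb{A}_D^*$ are invertible. The subconstituent algebra $\mathbb{T}$ is the subalgebra of the full matrix algebra generated by $\mathbb{A}_0,\ldots,\mathbb{A}_D,\mathbb{A}_0^*,\ldots,\mathbb{A}_D^*$; it contains $\mathbb{A}_{D}^{-1}\mathbb{A}_{D}^{*-1}\mathbb{A}_{D}\mathbb{A}_{D}^{*}$. A $\mathbb{T}$-module is a subspace $W\subseteq\mathbb{V}$ with $BW\subseteq W$ for all $B\in\mathbb{T}$; it is irreducible if it is nonzero and contains no $\mathbb{T}$-modules other than $0$ and $W$. The diameter of an irreducible $\mathbb{T}$-module $W$ is $|\{i\mid 0\le i\le D,\ \mathbb{E}_i^*W\ne 0\}|-1$. *)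

(* Defs.v *)
(* MathComp, with the real numbers of MathComp-Analysis and the complex
   numbers of MathComp-Real-Closed. *)
From HB Require Import structures.
From mathcomp Require Export all_boot all_order all_algebra.
From mathcomp Require Export reals complex.

Set Implicit Arguments.
Unset Strict Implicit.
Unset Printing Implicit Defensive.

Import Order.TTheory GRing.Theory Num.Theory.
Local Open Scope ring_scope.

(* The path-length distance of the graph with adjacency relation e: the least
   number of edges of a path from y to z.  A shortest path has fewer than #|T|
   edges, and #|T| is the value returned when there is no path at all. *)
Definition graph_dist (T : finType) (e : rel T) (y z : T) : nat :=
  find (fun n => [exists p : n.-tuple T, path e y p && (last y p == z)])
       (iota 0 #|T|).

Definition hvertex (D : nat) (X : finType) : finType := {ffun 'I_D -> X}.

Definition hamming_adj (D : nat) (X : finType) : rel (hvertex D X) :=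
  fun y z => #|[set k : 'I_D | y k != z k]| == 1%N.

Definition hdist (D : nat) (X : finType) (y z : hvertex D X) : nat :=
  graph_dist (@hamming_adj D X) y z.

(* Rows and columns are indexed by the vertices through enum_val/enum_rank. *)
Notation hmatrix C D X := 'M[C]_#|hvertex D X|.
Notation hvector C D X := 'cV[C]_#|hvertex D X|.

Section Hamming.
Variables (C : numClosedFieldType) (D : nat) (X : finType).
Implicit Types (i : nat) (x : X).

Definition dist_mx i : hmatrix C D X :=
  \matrix_(a, b) (hdist (enum_val a) (enum_val b) == i)%:R.

Definition hamming_eigval i : C :=
  (#|X|%:R - 1) * D%:R - #|X|%:R * i%:R.

(* eigenspace and proj_ortho describe row vectors and act on the right, the
   orthogonality being for the standard Hermitian form.  The two transpositions
   yield the matrix which, acting on column vectors on the left, projects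
   orthogonally onto the space of all v with dist_mx 1 *m v = hamming_eigval i *: v. *)
Definition prim_idem i : hmatrix C D X :=
  (proj_ortho (eigenspace (dist_mx 1)^T (hamming_eigval i)))^T.

Definition base_vertex x : hvertex D X := [ffun=> x].

Definition dual_idem x i : hmatrix C D X :=
  diag_mx (\row_b (hdist (base_vertex x) (enum_val b) == i)%:R).

Definition dual_dist_mx x i : hmatrix C D X :=
  diag_mx (\row_b (#|X|%:R ^+ D * prim_idem i (enum_rank (base_vertex x)) b)).

Inductive subconst_alg x : hmatrix C D X -> Prop :=
| subconst_dist i : (i <= D)%N -> subconst_alg x (dist_mx i)
| subconst_dual_dist i : (i <= D)%N -> subconst_alg x (dual_dist_mx x i)
| subconst_one : subconst_alg x 1%:M
| subconst_scale c A : subconst_alg x A -> subconst_alg x (c *: A)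
| subconst_add A B :
    subconst_alg x A -> subconst_alg x B -> subconst_alg x (A + B)
| subconst_mul A B :
    subconst_alg x A -> subconst_alg x B -> subconst_alg x (A *m B).

Definition lmul_end (B : hmatrix C D X) : 'End(hvector C D X) :=
  linfun (mulmx B).

Definition is_Tmodule x (W : {vspace hvector C D X}) : Prop :=
  forall B, subconst_alg x B -> (lmul_end B @: W <= W)%VS.

Definition irreducible_Tmodule x (W : {vspace hvector C D X}) : Prop :=
  [/\ is_Tmodule x W, W != 0%VS
    & forall U : {vspace hvector C D X},
        is_Tmodule x U -> (U <= W)%VS -> U = 0%VS \/ U = W].

Definition Tmodule_diameter x (W : {vspace hvector C D X}) : nat :=
  (#|[set i : 'I_D.+1 | (lmul_end (dual_idem x i) @: W)%VS != 0%VS]| - 1)%N.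

Definition D_commutator x : hmatrix C D X :=
  invmx (dist_mx D) *m invmx (dual_dist_mx x D) *m dist_mx D
    *m dual_dist_mx x D.

(* The endomorphism of W induced by B, meaningful when W is stable under B. *)
Definition action_on (W : {vspace hvector C D X}) (B : hmatrix C D X) :
    'End(subvs_of W) :=
  linfun (vsproj W \o (lmul_end B \o vsval)).

End Hamming.

Definition diagonalizable_end (K : fieldType) (V : vectType K) (f : 'End(V)) :
    Prop :=
  exists2 b : seq V, basis_of fullv b
    & forall v, v \in b -> exists a : K, f v = a *: v.

(* Main.v *)
(* Let e be the indicator of x and o the all-ones vector in C^X, and for a matrix t
   on C^X let sigma t be the sum over k of t acting on the k-th tensor factor of
   (C^X)^(tensor D).  Up to scalars and the identity, A_1 and A*_1 are sigma (o o^T)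
   and sigma (e e^T); they generate T, which contains the image under sigma of gl_2
   acting on the span of e and o.  The identity of gl_2 acts on W as a scalar, so W
   is an irreducible sl_2-module.
   On one factor the commutator a^-1 a*^-1 a a* fixes the orthogonal complement of e
   and o, and has eigenvectors e and o with eigenvalues 1 - r and (1 - r)^-1.  Hence
   if k is the Cartan element with k e = e and k o = - o, then the commutator of A_D
   and A*_D, a tensor power, acts as (1 - r)^s wherever sigma k acts as s, and sl_2
   theory gives s = n, n - 2, ..., - n, each once, with n + 1 = dim W.
   A second Cartan element, whose weight spaces in W are the nonzero E*_i W, shows
   that n is the diameter of W. *)
Require Import Defs.
From HB Require Import structures.
From mathcomp Require Import ring lra zify.

Set Implicit Arguments.
Unset Strict Implicit.
Unset Printing Implicit Defensive.

Import Order.TTheory GRing.Theory Num.Theory.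
Local Open Scope ring_scope.

(** * Eigenvectors for distinct eigenvalues, and finite-dimensional sl_2-modules *)

Section Eigenvectors.
Variables (K : fieldType) (vT : vectType K) (f : 'End(vT)).

Lemma mem_leigenspace (a : K) (v : vT) :
  (v \in passmx.leigenspace f a) = (f v == a *: v).
Proof. by rewrite memv_ker !lfun_simp subr_eq0. Qed.

(** If [w n] were a combination of the earlier vectors, applying [f - lam n] would give a relation
    among these with coefficients [c i * (lam i - lam n)]; freeness then kills every [c i], and with
    them [w n]. *)
Lemma eigenvectors_free (w : nat -> vT) (lam : nat -> K) (n : nat) :
  (forall i, (i < n)%N -> w i != 0) ->
  (forall i, (i < n)%N -> f (w i) = lam i *: w i) ->
  (forall i j, (j < n)%N -> (i < j)%N -> lam i != lam j) ->
  free (mkseq w n).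
Proof.
elim: n => [|n IHn] w_neq0 fw lam_inj; first exact: nil_free.
have w_free : free (mkseq w n).
  by apply: IHn => [i lt_in|i lt_in|i j lt_jn]; [apply: w_neq0|apply: fw|apply: lam_inj]; lia.
rewrite mkseqS -cats1 (perm_free (permEl (perm_catC _ _))) /= free_cons w_free andbT.
apply/negP => /(@coord_span _ _ _ (map_tuple w (iota_tuple n 0))) /= wn.
pose c i := coord (map_tuple w (iota_tuple n 0)) i (w n).
have nthw (i : 'I_n) : (mkseq w n)`_i = w i by rewrite nth_mkseq.
have rel0 : \sum_i (c i * (lam i - lam n)) *: (map_tuple w (iota_tuple n 0))`_i = 0.
  have := fw n (leqnn _); rewrite {1}wn linear_sum => /eqP.
  rewrite [X in lam n *: X]wn scaler_sumr -subr_eq0 -sumrB => /eqP eq0; rewrite -[RHS]eq0.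
  apply: eq_bigr => i _; rewrite linearZ /= nthw fw; last by rewrite ltnS ltnW.
  by rewrite !scalerA -scalerBl; congr (_ *: _); rewrite /c; ring.
have c0 i : c i = 0.
  have /freeP/(_ _ rel0 i)/eqP := w_free.
  rewrite mulf_eq0 subr_eq0 => /orP[/eqP //|eq_lam].
  by have := lam_inj i n (leqnn _) (ltn_ord i); rewrite eq_lam.
have := w_neq0 n (leqnn _); rewrite wn big1 ?eqxx // => i _.
by rewrite -/(c i) c0 scale0r.
Qed.

(** Otherwise one vector more than the dimension would form a free family. This is what ends the
    chains of raising and lowering operators below. *)
Lemma eigenvectors_vanish (w : nat -> vT) (lam : nat -> K) :
  (forall i, f (w i) = lam i *: w i) ->
  (forall i j, (i < j)%N -> lam i != lam j) ->
  exists i, w i == 0.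
Proof.
move=> fw lam_inj; pose n := (\dim {:vT}).+1.
have [/forallP w_neq0|/forallPn[i wi0]] := boolP [forall i : 'I_n, w i != 0]; last first.
  by exists i; rewrite -[_ == _]negbK.
have : free (mkseq w n).
  apply: (@eigenvectors_free w lam) => // [i lt_in|i j _].
    exact: (w_neq0 (Ordinal lt_in)).
  exact: lam_inj.
rewrite /free size_mkseq => /eqP dim_w.
by have := dimvS (subvf <<mkseq w n>>%VS); rewrite dim_w ltnn.
Qed.

End Eigenvectors.

(** An eigenvector for [a] has coordinates with [c i * (lam i - a) = 0], so it lies on the line of a
    single [w i]. A basis of weight vectors thus yields all three conclusions of the final
    theorem. *)
Lemma eigenbasis_leigenspace (K : fieldType) (vT : vectType K) (f : 'End(vT))
    (n : nat) (w : nat -> vT) (lam : nat -> K) :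
  basis_of fullv (mkseq w n) ->
  (forall i, (i < n)%N -> f (w i) = lam i *: w i) ->
  (forall i j, (j < n)%N -> (i < j)%N -> lam i != lam j) ->
  [/\ diagonalizable_end f,
      forall a, passmx.leigenvalue f a <-> exists2 i, (i < n)%N & a = lam i
    & forall a, passmx.leigenvalue f a -> \dim (passmx.leigenspace f a) = 1%N].
Proof.
move=> w_basis fw lam_inj; have w_free := basis_free w_basis.
have w_neq0 i : (i < n)%N -> w i != 0.
  move=> lt_in; apply: (free_not0 w_free).
  by apply/mapP; exists i; rewrite ?mem_iota.
have in_line a v : v \in passmx.leigenspace f a -> v != 0 ->
    exists i, [/\ (i < n)%N, a = lam i & v \in <[w i]>%VS].
  rewrite mem_leigenspace => /eqP fv v_neq0.
  pose c i := coord (map_tuple w (iota_tuple n 0)) i v.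
  have nthw (i : 'I_n) : (mkseq w n)`_i = w i by rewrite nth_mkseq.
  have vE : v = \sum_i c i *: w i.
    rewrite {1}(coord_basis (X := map_tuple w (iota_tuple n 0)) w_basis (memvf v)).
    by apply: eq_bigr => i _; rewrite nthw.
  have rel0 : \sum_i (c i * (lam i - a)) *: (map_tuple w (iota_tuple n 0))`_i = 0.
    move: fv; rewrite {1}vE linear_sum => /eqP.
    rewrite [X in a *: X]vE scaler_sumr -subr_eq0 -sumrB => /eqP eq0.
    rewrite -[RHS]eq0; apply: eq_bigr => i _.
    by rewrite linearZ /= nthw fw // !scalerA -scalerBl; congr (_ *: _); ring.
  have /freeP/(_ _ rel0) c0 := w_free.
  have [i ci0] : exists i, c i != 0.
    apply/existsP; apply: contraNT v_neq0; rewrite negb_exists => /forallP ci0.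
    by rewrite vE big1 // => i _; have := ci0 i; rewrite negbK => /eqP ->; rewrite scale0r.
  have aE j : c j != 0 -> a = lam j.
    by have /eqP := c0 j; rewrite mulf_eq0 => /orP[-> //|/eqP/subr0_eq].
  exists (i : nat); split; [exact: ltn_ord|exact: aE|].
  rewrite vE memv_suml // => j _.
  have [->|cj0] := eqVneq (c j) 0; first by rewrite scale0r mem0v.
  suff <- : j = i :> nat by rewrite memvZ ?memv_line.
  have eq_lam : lam i = lam j by rewrite -(aE i) -?(aE j).
  case: (ltngtP j i) => // lt_ji.
    by have := lam_inj _ _ (ltn_ord i) lt_ji; rewrite eq_lam eqxx.
  by have := lam_inj _ _ (ltn_ord j) lt_ji; rewrite eq_lam eqxx.
have wE i : (i < n)%N -> w i \in passmx.leigenspace f (lam i).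
  by move=> lt_in; rewrite mem_leigenspace fw.
have eigE a : passmx.leigenvalue f a ->
    exists2 i, (i < n)%N & a = lam i /\ passmx.leigenspace f a = <[w i]>%VS.
  move=> eig_a; have := eig_a; rewrite /passmx.leigenvalue -vpick0 => nz.
  have [i [lt_in aE _]] := in_line a _ (memv_pick _) nz.
  exists i => //; split => //; apply/eqP; rewrite eqEsubv -memvE aE wE // andbT.
  apply/subvP => v; have [-> _|v_neq0] := eqVneq v 0; first exact: mem0v.
  case/in_line => // j [lt_jn lamE].
  suff -> : j = i by [].
  case: (ltngtP j i) => // lt_ji.
    by have := lam_inj _ _ lt_in lt_ji; rewrite lamE eqxx.
  by have := lam_inj _ _ lt_jn lt_ji; rewrite lamE eqxx.
split.
- exists (mkseq w n) => // v /mapP[ i]; rewrite mem_iota /= => lt_in ->.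
  by exists (lam i); rewrite fw.
- move=> a; split=> [/eigE[i lt_in [-> _]]|[i lt_in ->]]; first by exists i.
  by apply: contraNneq (w_neq0 i lt_in) => E0; rewrite -memv0 -E0 wE.
- by move=> a /eigE[i lt_in [_ ->]]; rewrite dim_vline w_neq0.
Qed.

Lemma exists_eigenvector (C : numClosedFieldType) (vT : vectType C) (f : 'End(vT)) :
  (0 < \dim {:vT})%N -> exists a v, v != 0 /\ f v = a *: v.
Proof.
move=> dim_gt0; have e_basis := vbasisP {:vT}.
have [a] := eigenvalue_closed (passmx.mxof (vbasis {:vT}) (vbasis {:vT}) f) dim_gt0.
move=> /eigenvalueP[u uE u_neq0].
exists a, (passmx.vecof (vbasis {:vT}) u); split.
  by rewrite passmx.vecof_eq0.
rewrite (passmx.hom_vecof _ e_basis) uE scaler_sumr.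
by apply: eq_bigr => i _; rewrite mxE scalerA.
Qed.

(** Highest weight theory: climbing with [E] from an eigenvector of [H] ends at some [x0] killed by
    [E], and descending from [x0] with [F] gives a chain whose span is stable under [E] and [F],
    hence is everything. *)
Lemma sl2_weight_basis (C : numClosedFieldType) (vT : vectType C)
    (E F H : 'End(vT)) :
  (0 < \dim {:vT})%N ->
  (forall v, E (F v) - F (E v) = H v) ->
  (forall v, H (E v) - E (H v) = 2 *: E v) ->
  (forall v, H (F v) - F (H v) = - 2 *: F v) ->
  (forall U : {vspace vT}, (forall u, u \in U -> E u \in U) ->
     (forall u, u \in U -> F u \in U) -> U = 0%VS \/ U = fullv) ->
  exists n (w : nat -> vT), basis_of fullv (mkseq w n.+1) /\
    forall i, (i < n.+1)%N -> H (w i) = (n%:R - i.*2%:R) *: w i.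
Proof.
move=> dim_gt0 EF HE HF irr.
have [mu [v0 [v0_neq0 Hv0]]] := exists_eigenvector H dim_gt0.
have lam_inj (a c : C) i j : c != 0 -> (i < j)%N -> a + c * i%:R != a + c * j%:R.
  move=> c_neq0 lt_ij; rewrite (inj_eq (addrI a)) (inj_eq (mulfI c_neq0)) eqr_nat.
  by rewrite ltn_eqF.
have HEi i : H (iter i E v0) = (mu + 2 * i%:R) *: iter i E v0.
  elim: i => [|i IHi]; first by rewrite mulr0 addr0.
  have /(canRL (subrK _)) := HE (iter i E v0); rewrite IHi linearZ /= => ->.
  by rewrite -scalerDl; congr (_ *: _); rewrite -natr1; ring.
have [|i0 i0P] := eigenvectors_vanish HEi _.
  by move=> i j; apply: lam_inj; rewrite pnatr_eq0.
have /ex_minnP[m m0 m_min] : exists i, iter i E v0 == 0 by exists i0.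
have m_gt0 : (0 < m)%N by case: m m0 {m_min} => //=; rewrite (negPf v0_neq0).
(* [m] is the first exponent at which the chain vanishes, and it is positive, so [m.-1] marks the
   last nonzero vector. *)
pose x0 := iter m.-1 E v0; pose lam := mu + 2 * m.-1%:R.
have x0_neq0 : x0 != 0 by apply/negP => /m_min; lia.
have Ex0 : E x0 = 0 by apply/eqP; rewrite -iterS prednK.
have Hx0 : H x0 = lam *: x0 by exact: HEi.
pose w i := iter i F x0.
have Hw i : H (w i) = (lam + (- 2) * i%:R) *: w i.
  elim: i => [|i IHi]; first by rewrite mulr0 addr0.
  have /(canRL (subrK _)) := HF (w i); rewrite IHi linearZ /= => ->.
  by rewrite -scalerDl; congr (_ *: _); rewrite -natr1; ring.
(* Moving [E] past each [F] in turn adds up the weights lam, lam - 2, ..., lam - 2 i, whose sum is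
   (i + 1)(lam - i). *)
have Ew i : E (w i.+1) = (i.+1%:R * (lam - i%:R)) *: w i.
  elim: i => [|i IHi].
    have /(canRL (subrK _)) := EF x0; rewrite Ex0 linear0 addr0 Hx0 => ->.
    by congr (_ *: _); ring.
  have /(canRL (subrK _)) := EF (w i.+1); rewrite Hw IHi linearZ => ->.
  by rewrite -scalerDl; congr (_ *: _); rewrite -!natr1; ring.
have [|i1 i1P] := eigenvectors_vanish Hw _.
  by move=> i j; apply: lam_inj; rewrite oppr_eq0 pnatr_eq0.
have /ex_minnP[N N0 N_min] : exists i, w i == 0 by exists i1.
case: N N0 N_min => [|n]; first by rewrite /w /= (negPf x0_neq0).
move=> wn0 n_min.
have w_neq0 i : (i < n.+1)%N -> w i != 0.
  by move=> lt_in; apply/negP => /n_min; rewrite leqNgt lt_in.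
(* At the end of the chain [w n.+1] is zero and [w n] is not, so the coefficient (n + 1)(lam - n)
   vanishes; the characteristic is 0. *)
have lamE : lam = n%:R.
  have := Ew n; rewrite (eqP wn0) linear0 => /esym/eqP.
  rewrite scaler_eq0 (negPf (w_neq0 n (leqnn _))) orbF mulf_eq0 pnatr_eq0 /=.
  by rewrite subr_eq0 => /eqP.
exists n, w; split; last first.
  move=> i _; rewrite Hw lamE; congr (_ *: _); rewrite -muln2 natrM; ring.
have w_free : free (mkseq w n.+1).
  apply: (@eigenvectors_free _ _ H w) w_neq0 (fun i _ => Hw i) _ => i j _.
  by apply: lam_inj; rewrite oppr_eq0 pnatr_eq0.
rewrite /basis_of w_free andbT; apply/eqP.
have memw i : w i \in <<mkseq w n.+1>>%VS.
  have [lt_in|le_ni] := ltnP i n.+1.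
    by apply: memv_span; apply/mapP; exists i; rewrite ?mem_iota.
  suff -> : w i = 0 by exact: mem0v.
  rewrite -(subnK le_ni); elim: (i - _)%N => [|k IHk]; first exact/eqP.
  by rewrite addSn /w iterS -/(w _) IHk linear0.
have stable (G : 'End(vT)) : (forall i, G (w i) \in <<mkseq w n.+1>>%VS) ->
    forall u, u \in <<mkseq w n.+1>>%VS -> G u \in <<mkseq w n.+1>>%VS.
  move=> Gw u /(@coord_span _ _ _ (map_tuple w (iota_tuple n.+1 0))) ->.
  rewrite linear_sum memv_suml // => i _; rewrite linearZ memvZ //.
  by have /= -> := nth_mkseq 0 w (ltn_ord i).
have [||eq0 //|//] := irr <<mkseq w n.+1>>%VS.
- by apply: stable => - [|i]; [rewrite Ex0 mem0v|rewrite Ew memvZ].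
- by apply: stable => i; rewrite -[F _]/(w i.+1).
by have := memw 0%N; rewrite eq0 memv0 (negPf x0_neq0).
Qed.

(** * Kronecker products, and one-factor matrices acting on the tensor power *)

Section Tensor.
Variables (C : numClosedFieldType) (D : nat) (X : finType).
Local Notation smatrix := 'M[C]_#|X|.

Lemma sum_enum_val (T : finType) (F : T -> C) :
  \sum_(a < #|T|) F (enum_val a) = \sum_y F y.
Proof.
rewrite [RHS](reindex (fun a : 'I_#|T| => enum_val a)) //.
by apply: onW_bij; apply: enum_val_bij.
Qed.

Definition vcoord (a : 'I_#|hvertex D X|) (k : 'I_D) : 'I_#|X| :=
  enum_rank ((enum_val a : hvertex D X) k).

Lemma vcoord_inj a b : vcoord a =1 vcoord b -> a = b.
Proof. by move=> eq_ab; apply/enum_val_inj/ffunP => k; apply/enum_rank_inj/eq_ab. Qed.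

Definition tens (m : 'I_D -> smatrix) : hmatrix C D X :=
  \matrix_(a, b) \prod_k m k (vcoord a k) (vcoord b k).

Lemma eq_tens m n : m =1 n -> tens m = tens n.
Proof. by move=> mn; apply/matrixP => a b; rewrite !mxE; apply: eq_bigr => k _; rewrite mn. Qed.

(** Distributivity: a sum over vertices of a product over coordinates is the product of the sums
    over each coordinate. *)
Lemma tens_mul m n : tens m *m tens n = tens (fun k => m k *m n k).
Proof.
apply/matrixP => a b; rewrite !mxE.
pose F k (c : X) := m k (vcoord a k) (enum_rank c) *
              n k (enum_rank c) (vcoord b k).
transitivity (\sum_(y : hvertex D X) \prod_k F k (y k)).
  rewrite -[RHS]sum_enum_val; apply: eq_bigr => c _.
  by rewrite !mxE -big_split.
rewrite -bigA_distr_bigA; apply: eq_bigr => k _.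
rewrite mxE -[LHS]sum_enum_val; apply: eq_bigr => c _.
by rewrite /F enum_valK.
Qed.

Lemma tens1 : tens (fun=> 1%:M) = 1%:M.
Proof.
apply/matrixP => a b; rewrite !mxE; have [->|neq_ab] := eqVneq a b.
  by rewrite big1 // => k _; rewrite mxE eqxx.
have /existsP[k neq_k] : [exists k, vcoord a k != vcoord b k].
  apply: contraNT neq_ab; rewrite negb_exists => /forallP eq_ab.
  by apply/eqP/vcoord_inj => k; have /negPn/eqP := eq_ab k.
by rewrite (bigD1 k) //= mxE (negPf neq_k) mul0r.
Qed.

Lemma tens_scale (c : 'I_D -> C) m :
  tens (fun k => c k *: m k) = (\prod_k c k) *: tens m.
Proof.
apply/matrixP => a b; rewrite !mxE -big_split; apply: eq_bigr => k _.
by rewrite !mxE.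
Qed.

(** Distributivity again; with [p] a resolution of the identity, it splits the tensor power into
    joint components. *)
Lemma sum_tens (I : finType) (p : I -> smatrix) :
  \sum_(s : {ffun 'I_D -> I}) tens (fun k => p (s k)) = tens (fun=> \sum_i p i).
Proof.
apply/matrixP => a b; rewrite summxE !mxE.
under [RHS]eq_bigr => k _ do rewrite summxE.
by rewrite bigA_distr_bigA; apply: eq_bigr => s _; rewrite mxE.
Qed.

Definition site (k : 'I_D) (t : smatrix) :=
  tens (fun j => if j == k then t else 1%:M).

Lemma siteE k t a b :
  site k t a b = t (vcoord a k) (vcoord b k) *
    [forall j, (j != k) ==> (vcoord a j == vcoord b j)]%:R.
Proof.
rewrite mxE (bigD1 k) //= eqxx; congr (_ * _).
case: (boolP [forall j, (j != k) ==> (vcoord a j == vcoord b j)]) => [/forallP eq_ab|].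
  rewrite big1 // => j neq_jk; have := eq_ab j; rewrite (negPf neq_jk) /= => /eqP ->.
  by rewrite mxE eqxx.
rewrite negb_forall => /existsP[j]; rewrite negb_imply => /andP[neq_jk neq_ab].
by rewrite (bigD1 j) //= (negPf neq_jk) mxE (negPf neq_ab) mul0r.
Qed.

Fact site_is_linear k : linear (site k).
Proof. by move=> c s t; apply/matrixP => a b; rewrite !(siteE, mxE); ring. Qed.

HB.instance Definition _ k := GRing.isLinear.Build C smatrix (hmatrix C D X) _
  (site k) (site_is_linear k).

Lemma site_commutator k l s t :
  site k s *m site l t - site l t *m site k s =
    if k == l then site k (s *m t - t *m s) else 0.
Proof.
have [<-|neq_kl] := eqVneq k l.
  rewrite linearB; congr (_ - _); rewrite tens_mul; apply: eq_tens => j;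
    by case: eqP; rewrite ?mul1mx.
apply/eqP; rewrite subr_eq0 !tens_mul; apply/eqP/eq_tens => j.
case: (eqVneq j k) => [->|_]; first by rewrite (negPf neq_kl) mulmx1 mul1mx.
by case: eqP; rewrite ?mulmx1 ?mul1mx.
Qed.

Lemma site_tens k t m :
  site k t *m tens m = tens (fun j => if j == k then t *m m j else m j).
Proof.
by rewrite tens_mul; apply: eq_tens => j; case: eqP; rewrite ?mul1mx.
Qed.

Lemma tens_site k t m :
  tens m *m site k t = tens (fun j => if j == k then m j *m t else m j).
Proof.
by rewrite tens_mul; apply: eq_tens => j; case: eqP; rewrite ?mulmx1.
Qed.

Definition sigma (t : smatrix) := \sum_(k < D) site k t.

Fact sigma_is_linear : linear sigma.
Proof.
move=> c s t; rewrite /sigma scaler_sumr -big_split; apply: eq_bigr => k _.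
exact: linearP.
Qed.

HB.instance Definition _ := GRing.isLinear.Build C smatrix (hmatrix C D X) _ sigma
  sigma_is_linear.

Lemma sigma1 : sigma 1%:M = D%:R%:M.
Proof.
rewrite /sigma (eq_bigr (fun=> 1%:M)) => [|k _].
  by rewrite sumr_const card_ord -scaler_nat scalemx1.
by rewrite -tens1; apply: eq_tens => j; rewrite if_same.
Qed.

(** Matrices on different factors commute, so only the terms with equal indices survive: [sigma] is
    a homomorphism of Lie algebras. *)
Lemma sigma_commutator s t :
  sigma s *m sigma t - sigma t *m sigma s = sigma (s *m t - t *m s).
Proof.
rewrite /sigma !mulmx_suml.
under eq_bigr do rewrite mulmx_sumr.
under [in X in _ - X]eq_bigr do rewrite mulmx_sumr.
rewrite [X in _ - X]exchange_big -sumrB; apply: eq_bigr => k _.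
rewrite -sumrB (bigD1 k) //= site_commutator eqxx big1 ?addr0 // => l neq_lk.
by rewrite site_commutator eq_sym (negPf neq_lk).
Qed.

End Tensor.

(** * Path-length distance as the number of differing coordinates *)

Section HammingDistance.
Variables (D : nat) (X : finType).
Implicit Types (y z w : hvertex D X) (k : 'I_D) (c : X).

Definition hamm y z := #|[set k | y k != z k]|.

Lemma hamm_sum y z : hamm y z = (\sum_k (y k != z k))%N.
Proof.
by rewrite /hamm -sum1_card big_mkcond; apply: eq_bigr => k _; rewrite inE; case: eqP.
Qed.

Lemma hamm_refl y : hamm y y = 0%N.
Proof. by rewrite hamm_sum big1 // => k _; rewrite eqxx. Qed.

Lemma hamm_sym y z : hamm y z = hamm z y.
Proof. by rewrite !hamm_sum; apply: eq_bigr => k _; rewrite eq_sym. Qed.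

Lemma hamm_eq0 y z : (hamm y z == 0%N) = (y == z).
Proof.
apply/idP/eqP => [|->]; last by rewrite hamm_refl.
rewrite hamm_sum sum_nat_eq0 => /forallP eq_yz; apply/ffunP => k.
by have := eq_yz k; rewrite eqb0 negbK => /eqP.
Qed.

Lemma hamm_leq y z : (hamm y z <= D)%N.
Proof. by rewrite -[D in (_ <= D)%N]card_ord; apply: max_card. Qed.

Lemma hamm_triangle y w z : (hamm y z <= hamm y w + hamm w z)%N.
Proof.
rewrite !hamm_sum -big_split /=; apply: leq_sum => k _.
by case: (eqVneq (y k) (w k)) => [->|_] //; case: (_ != z k).
Qed.

Definition upd y k c : hvertex D X := [ffun j => if j == k then c else y j].

(** Only the summand at [k] changes; the additive form avoids truncated subtraction. *)
Lemma hamm_upd y k c z :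
  (hamm (upd y k c) z + (y k != z k) = hamm y z + (c != z k))%N.
Proof.
rewrite !hamm_sum (bigD1 k) //= [in RHS](bigD1 k) //= ffunE eqxx.
rewrite (eq_bigr (fun j => nat_of_bool (y j != z j))) => [|j /negPf neq_jk].
  by rewrite addnC addnCA [RHS]addnC.
by rewrite ffunE neq_jk.
Qed.

Lemma hamm_updl y k c : hamm y (upd y k c) = (c != y k).
Proof. by have := hamm_upd y k c y; rewrite hamm_refl eqxx addn0 hamm_sym. Qed.

Lemma upd_eq y w k :
  (w == upd y k (w k)) = [forall j, (j != k) ==> (y j == w j)].
Proof.
apply/eqP/forallP => [eq_w j|eq_yw].
  by apply/implyP => /negPf neq_jk; rewrite {1}eq_w ffunE neq_jk.
apply/ffunP => j; rewrite ffunE; case: eqP => [-> //|/eqP neq_jk].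
by have := eq_yw j; rewrite neq_jk => /eqP.
Qed.

Lemma hamm_eq1P y w : reflect (exists2 k, w k != y k & w = upd y k (w k)) (hamm y w == 1%N).
Proof.
apply: (iffP cards1P) => [[k diffE]|[k neq_k wE]].
  have kP j : (y j != w j) = (j == k) by have /setP/(_ j) := diffE; rewrite !inE.
  exists k; first by rewrite eq_sym kP.
  apply/eqP; rewrite upd_eq; apply/forallP => j; apply/implyP.
  by rewrite -kP negbK.
exists k; apply/setP => j; rewrite !inE wE ffunE.
by case: (j =P k) => [->|_]; rewrite ?eqxx // eq_sym.
Qed.

Lemma hamm_path_leq y (p : seq (hvertex D X)) :
  path (@hamming_adj D X) y p -> (hamm y (last y p) <= size p)%N.
Proof.
elim: p y => [|w p IHp] y /=; first by rewrite hamm_refl.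
move=> /andP[/eqP yw /IHp le_p]; apply: leq_trans (hamm_triangle y w _) _.
by rewrite [hamm y w]yw.
Qed.

(** The path corrects one differing coordinate at a time. *)
Lemma hamm_path y z : exists p : (hamm y z).-tuple (hvertex D X),
  path (@hamming_adj D X) y p && (last y p == z).
Proof.
move: {2}(hamm y z) (erefl (hamm y z)) => n; elim: n y => [|n IHn] y yz.
  by rewrite yz; exists [tuple] => /=; rewrite -hamm_eq0 yz.
have /existsP[k neq_k] : [exists k, y k != z k].
  have [//|/existsPn eq_yz] := boolP [exists k, y k != z k].
  by move: yz; rewrite hamm_sum big1 // => k _; rewrite (negPf (eq_yz k)).
have wz : hamm (upd y k (z k)) z = n.
  by have := hamm_upd y k (z k) z; rewrite neq_k eqxx; lia.
have [p] := IHn _ wz; rewrite yz; move: p; rewrite wz => p pP.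
exists [tuple of upd y k (z k) :: p] => /=.
case/andP: pP => -> ->; rewrite !andbT /hamming_adj -/(hamm _ _).
by rewrite hamm_updl [z k == _]eq_sym neq_k.
Qed.

Lemma find_iota (a : pred nat) m N :
  (m < N)%N -> a m -> (forall i, a i -> (m <= i)%N) -> find a (iota 0 N) = m.
Proof.
move=> lt_mN am m_min.
have hasa : has a (iota 0 N) by apply/hasP; exists m; rewrite ?mem_iota.
have lt_f : (find a (iota 0 N) < N)%N by rewrite -[X in (_ < X)%N](size_iota 0) -has_find.
apply/eqP; rewrite eqn_leq m_min ?andbT; last first.
  by have := nth_find 0%N hasa; rewrite nth_iota.
rewrite leqNgt; apply/negP => /(before_find 0%N).
by rewrite nth_iota // am.
Qed.

(** No path is shorter, since an edge changes only one coordinate. As [graph_dist] searches only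
    below the number of vertices, the bound [D < #|X| ^ D] enters too. *)
Lemma hdistE y z : (1 < #|X|)%N -> hdist y z = hamm y z.
Proof.
move=> X_gt1; apply: find_iota => [||n].
- apply: leq_ltn_trans (hamm_leq y z) _; rewrite card_ffun card_ord.
  exact: ltn_expl.
- exact/existsP/hamm_path.
- move=> /existsP[p /andP[p_path /eqP <-]].
  by rewrite -[X in (_ <= X)%N](size_tuple p) hamm_path_leq.
Qed.

End HammingDistance.

(** * Distance matrices as polynomials in A_1 *)

Section DistanceMatrices.
Variables (C : numClosedFieldType) (D : nat) (X : finType).
Local Notation smatrix := 'M[C]_#|X|.
Local Notation r := (#|X|%:R : C).
Implicit Types (a b : 'I_#|hvertex D X|) (phi psi : nat -> C).

Definition hval a : hvertex D X := enum_val a.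

Lemma vcoord_eq a b k : (vcoord a k == vcoord b k) = (hval a k == hval b k).
Proof. by rewrite (inj_eq enum_rank_inj). Qed.

(** In row [a], [site k t] is supported on the vertices that agree with [a] off [k], parametrized by
    their [k]-th coordinate [c]. *)
Lemma site_mul k (t : smatrix) (M : hmatrix C D X) a b :
  (site k t *m M) a b =
    \sum_(c : X) t (vcoord a k) (enum_rank c) * M (enum_rank (upd (hval a) k c)) b.
Proof.
rewrite mxE -[RHS]/(\sum_(c : X) _).
pose F (w : hvertex D X) := t (vcoord a k) (enum_rank (w k)) * M (enum_rank w) b.
transitivity (\sum_(w : hvertex D X | w == upd (hval a) k (w k)) F w).
  rewrite [RHS]big_mkcond -[RHS]sum_enum_val; apply: eq_bigr => e _.
  rewrite siteE upd_eq /F enum_valK.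
  under eq_forallb => j do rewrite vcoord_eq.
  by case: ifP; rewrite ?mulr1 // mulr0 mul0r.
rewrite (reindex_onto (upd (hval a) k) (fun w : hvertex D X => w k)) => [|w /eqP <- //].
apply: eq_big => [c|c _]; first by rewrite ffunE !eqxx.
by rewrite /F ffunE eqxx.
Qed.

Definition hdm phi : hmatrix C D X := \matrix_(a, b) phi (hamm (hval a) (hval b)).

Lemma trmx_hdm phi : (hdm phi)^T = hdm phi.
Proof. by apply/matrixP => a b; rewrite !mxE hamm_sym. Qed.

Definition adj_mx : smatrix := const_mx 1 - 1%:M.

Lemma sum_delta (T : finType) (u : T) (c : C) : \sum_(v : T) (v == u)%:R * c = c.
Proof.
rewrite (bigD1 u) //= eqxx mul1r big1 ?addr0 // => v /negPf ->; exact: mul0r.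
Qed.

(** The coefficients are the intersection numbers: at distance [d], each of the [D - d] agreeing
    coordinates can be spoiled in [r - 1] ways, and each of the [d] others has one correcting change
    and [r - 2] neutral ones. The values [phi d.-1] at [d = 0] and [phi d.+1] at [d = D] carry the
    factor 0. *)
Lemma adj_mul_hdm phi :
  sigma D adj_mx *m hdm phi =
    hdm (fun d => (D%:R - d%:R) * (r - 1) * phi d.+1 + d%:R * phi d.-1
                  + d%:R * (r - 2) * phi d).
Proof.
apply/matrixP => a b; rewrite mulmx_suml summxE [RHS]mxE.
set y := hval a; set z := hval b; set d := hamm y z.
(* [beta] is the contribution of a coordinate where [y] and [z] agree, [alpha] that of one where
   they differ. *)
pose alpha := phi d.-1 + (r - 2) * phi d; pose beta := (r - 1) * phi d.+1.
transitivity (\sum_(k < D) (beta + (y k != z k)%:R * (alpha - beta))); last first.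
  rewrite big_split /= sumr_const card_ord -mulr_suml -natr_sum -hamm_sum -/d.
  by rewrite /alpha /beta -mulr_natl; ring.
apply: eq_bigr => k _; rewrite site_mul.
have entry c : adj_mx (vcoord a k) (enum_rank c) = 1 - (c == y k)%:R.
  by rewrite !mxE (inj_eq enum_rank_inj) eq_sym.
have sum1 (c : C) : \sum_(v : X) c = r * c by rewrite sumr_const mulr_natl.
have [eq_k|neq_k] := eqVneq (y k) (z k).
  rewrite mul0r addr0.
  transitivity (\sum_(c : X) (phi d.+1 + (c == y k)%:R * (- phi d.+1))).
    apply: eq_bigr => c _; rewrite entry mxE /hval enum_rankK -/(hval a) -/(hval b).
    have [->|neq_c] := eqVneq c (y k); first by rewrite subrr mul0r mul1r subrr.
    have := hamm_upd y k c z; rewrite -eq_k neq_c eqxx addn0 addn1 => ->.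
    by rewrite subr0 mul0r mul1r addr0.
  by rewrite big_split /= sum1 sum_delta /beta; ring.
rewrite mul1r addrC subrK.
(* The summand is [phi d] except at [c = y k], where the adjacency entry is 0, and at [c = z k],
   where the distance drops by one. *)
transitivity (\sum_(c : X) (phi d + (c == y k)%:R * (- phi d)
                            + (c == z k)%:R * (phi d.-1 - phi d))).
  apply: eq_bigr => c _; rewrite entry mxE /hval enum_rankK -/(hval a) -/(hval b).
  have [->|neq_c] := eqVneq c (y k).
    by rewrite subrr mul0r (negPf neq_k) mul1r subrr mul0r addr0.
  have := hamm_upd y k c z; rewrite neq_k -/d /=.
  have [->|neq_cz] := eqVneq c (z k).
    by rewrite addn0 addn1 => <- /=; rewrite subr0 mul0r !mul1r addr0 addrC subrK.
  by rewrite !addn1 => -[->]; rewrite subr0 !mul0r mul1r !addr0.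
by rewrite !big_split /= sum1 !sum_delta /alpha; ring.
Qed.

Hypothesis X_gt1 : (1 < #|X|)%N.

Lemma dist_mxE i : dist_mx C D X i = hdm (fun d => (d == i)%:R).
Proof. by apply/matrixP => a b; rewrite !mxE hdistE. Qed.

Lemma dist_mx1E : dist_mx C D X 1 = sigma D adj_mx.
Proof.
rewrite dist_mxE; apply/matrixP => a b; rewrite mxE summxE.
have entry k : adj_mx (vcoord a k) (vcoord b k) = (hval b k != hval a k)%:R.
  by rewrite !mxE vcoord_eq [in RHS]eq_sym; case: (hval a k == _); rewrite ?subrr ?subr0.
under eq_bigr => k _.
  rewrite siteE entry; under eq_forallb => j do rewrite vcoord_eq.
  rewrite -upd_eq -natrM mulnb; over.
case: hamm_eq1P => [[k neq_k bE]|no_k].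
  rewrite (bigD1 k) //= neq_k -bE eqxx big1 ?addr0 // => j neq_jk.
  by rewrite bE !ffunE (negPf neq_jk) eqxx.
rewrite big1 // => k _; case: andP => // -[neq_k /eqP bE].
by case: no_k; exists k.
Qed.

(** At distance [D] all coordinates differ, so the entry is a product over the coordinates. *)
Lemma dist_mx_D : dist_mx C D X D = tens (fun=> adj_mx).
Proof.
rewrite dist_mxE; apply/matrixP => a b; rewrite !mxE.
have entry k : adj_mx (vcoord a k) (vcoord b k) = (hval a k != hval b k)%:R.
  by rewrite !mxE vcoord_eq; case: (hval a k == _); rewrite ?subrr ?subr0.
rewrite (eq_bigr _ (fun k _ => entry k)) hamm_sum.
have [/forallP neq_ab|] := boolP [forall k, hval a k != hval b k].
  rewrite [RHS]big1 => [|k _]; last by rewrite neq_ab.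
  rewrite (eq_bigr (fun=> 1%N)) => [|k _]; last by rewrite neq_ab.
  by rewrite sum1_card card_ord eqxx.
rewrite negb_forall => /existsP[k /negPf eq_ab].
rewrite [RHS](bigD1 k) //= eq_ab mul0r (bigD1 k) //= eq_ab add0n.
rewrite ltn_eqF // -[X in (_ < X)%N]card_ord (cardD1 k) inE add1n ltnS -sum1_card.
rewrite [X in (_ <= X)%N](eq_bigl (fun j => j != k)) => [|j]; last first.
  by rewrite !inE andbT.
by apply: leq_sum => j _; apply: leq_b1.
Qed.

(** Every A_i is a polynomial in A_1, by the three-term recurrence [step]; its leading coefficient
    [i.+2] is invertible in characteristic 0. *)
Lemma dist_mx_ind (P : hmatrix C D X -> Prop) :
  P 1%:M -> (forall c A B, P A -> P B -> P (c *: A + B)) ->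
  (forall A, P A -> P (dist_mx C D X 1 *m A)) -> forall i, P (dist_mx C D X i).
Proof.
move=> P1 Plin PA.
have P0 : P 0 by have := Plin (-1) _ _ P1 P1; rewrite scaleN1r addNr.
have PZ c A : P A -> P (c *: A) by move=> PA'; have := Plin c A 0 PA' P0; rewrite addr0.
have dist0 : dist_mx C D X 0 = 1%:M.
  by rewrite dist_mxE; apply/matrixP => a b; rewrite !mxE hamm_eq0 (inj_eq enum_val_inj).
have step i : dist_mx C D X i.+2 = i.+2%:R^-1 *:
    (dist_mx C D X 1 *m dist_mx C D X i.+1
      + - ((D%:R - i%:R) * (r - 1)) *: dist_mx C D X i
      + - (i.+1%:R * (r - 2)) *: dist_mx C D X i.+1).
  rewrite [dist_mx C D X 1]dist_mx1E !dist_mxE adj_mul_hdm.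
  apply/matrixP => a b; rewrite !mxE; set d := hamm _ _.
  have i_neq0 : i.+2%:R != 0 :> C by rewrite pnatr_eq0.
  apply: (mulfI i_neq0); rewrite mulVKf // eqSS.
  (* Each indicator allows the [d] in its coefficient to be replaced by the one value where the
     indicator is nonzero. *)
  have -> : (D%:R - d%:R) * (r - 1) * (d.+1 == i.+1)%:R
          = (D%:R - i%:R) * (r - 1) * (d == i)%:R.
    by rewrite eqSS; case: eqP => [->|]; rewrite ?mulr0.
  have -> : d%:R * (d.-1 == i.+1)%:R = i.+2%:R * (d == i.+2)%:R :> C.
    case: d => [|d']; first by rewrite mul0r mulr0.
    by rewrite /= [in RHS]eqSS; case: eqP => [->|]; rewrite ?mulr0.
  have -> : d%:R * (r - 2) * (d == i.+1)%:R = i.+1%:R * (r - 2) * (d == i.+1)%:R.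
    by case: eqP => [->|]; rewrite ?mulr0.
  by ring.
suff : forall i, P (dist_mx C D X i) /\ P (dist_mx C D X i.+1) by move=> H i; case: (H i).
elim=> [|i [Pi Pi1]].
  by split; rewrite ?dist0 // -[dist_mx _ _ _ _]mulmx1; apply: PA.
split=> //; rewrite step; apply: PZ; rewrite addrC; apply: (Plin) => //.
by rewrite addrC; apply: Plin => //; apply: PA.
Qed.

End DistanceMatrices.

(** * Generating functions of the Krawtchouk polynomials *)

Section Krawtchouk.
Variables (C : numClosedFieldType) (D : nat) (X : finType).
Local Notation r := (#|X|%:R : C).

(* Generating function in i of the entries of r^D E_i at pairs of vertices at
   distance d. *)
Definition krawt d : {poly C} := (1 + (r - 1) *: 'X) ^+ (D - d) * (1 - 'X) ^+ d.

(** Evaluation at 1 sums the coefficients; this is how the E_i are seen to sum to the identity. *)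
Lemma krawt_horner1 d : (d <= D)%N -> (krawt d).[1] = (d == 0%N)%:R * r ^+ D.
Proof.
move=> le_dD; rewrite /krawt hornerM !horner_exp !hornerD hornerN hornerZ hornerX.
rewrite -polyC1 !hornerC mulr1 addrC subrK subrr expr0n mulrC.
by case: d le_dD => [|d] _; rewrite ?subn0 ?mul0r.
Qed.

(** These are the dual eigenvalues, the diagonal entries of A*_1. *)
Lemma coef1_krawt d : (d <= D)%N -> (krawt d)`_1 = r * (D%:R - d%:R) - D%:R.
Proof.
move=> le_dD; have -> : (krawt d)`_1 = (krawt d)^`().[0] by rewrite horner_coef0 coef_deriv.
rewrite /krawt derivM !deriv_exp derivD derivB derivZ derivX -polyC1 derivC.
rewrite !(hornerD, hornerN, hornerM, hornerMn, horner_exp, hornerZ, hornerX, hornerC).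
rewrite !mulr0 subr0 addr0 !expr1n !mulr1 add0r sub0r.
by rewrite -[_ *+ (D - d)]mulr_natl natrB // -[_ *+ d]mulr_natl; ring.
Qed.

(** Both linear factors have degree 1, as [r - 1] is nonzero. The top coefficient is the diagonal
    entry of A*_D at distance [d]. *)
Lemma size_lead_krawt d : (1 < #|X|)%N -> (d <= D)%N ->
  size (krawt d) = D.+1 /\ (krawt d)`_D = (r - 1) ^+ (D - d) * (- 1) ^+ d.
Proof.
move=> X_gt1 le_dD.
have r1_neq0 : r - 1 != 0 by rewrite subr_eq0 pnatr_eq1 gtn_eqF.
have lt_size : (size (1%R : {poly C}) < size ((r - 1) *: 'X : {poly C})%R)%N.
  by rewrite size_scale // size_polyX size_poly1.
have size_p : size (1 + (r - 1) *: 'X : {poly C}) = 2%N.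
  by rewrite addrC size_polyDl // size_scale // size_polyX.
have lead_p : lead_coef (1 + (r - 1) *: 'X : {poly C}) = r - 1.
  by rewrite lead_coefDr // lead_coefZ lead_coefX mulr1.
have oppXE : 1 - 'X = - ('X - 1%:P) :> {poly C} by rewrite opprB.
have size_q : size (1 - 'X : {poly C}) = 2%N by rewrite oppXE size_polyN size_XsubC.
have lead_q : lead_coef (1 - 'X : {poly C}) = - 1.
  by rewrite oppXE lead_coefN lead_coefXsubC.
have nz (p : {poly C}) n : size p = 2%N -> p ^+ n != 0.
  by move=> sz_p; rewrite expf_neq0 // -size_poly_eq0 sz_p.
have sz (p : {poly C}) n : size p = 2%N -> size (p ^+ n) = n.+1.
  move=> sz_p; rewrite -[LHS]prednK ?size_exp ?sz_p ?mul1n //.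
  by rewrite lt0n size_poly_eq0 nz.
have szk : size (krawt d) = D.+1.
  by rewrite /krawt size_mul ?nz // !sz // addSn addnS /= subnK.
split=> //; have -> : (krawt d)`_D = lead_coef (krawt d) by rewrite lead_coefE szk.
by rewrite lead_coefM !lead_coef_exp lead_p lead_q.
Qed.

(** On the coefficient of X^i, where X d/dX acts as [i], this says that A_1 multiplies the candidate
    for E_i by (r - 1) D - r i. *)
Lemma krawt_recurrence d : (d <= D)%N ->
  ((D%:R - d%:R) * (r - 1)) *: krawt d.+1 + d%:R *: krawt d.-1 + (d%:R * (r - 2)) *: krawt d
    = ((r - 1) * D%:R) *: krawt d - r *: ('X * (krawt d)^`()).
Proof.
move=> le_dD; have DE : D%:R = (D - d)%:R + d%:R :> C by rewrite -natrD subnK.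
(* At [d = 0] the exponents [D - d.-1] and [(D - d).+1] differ, but both sides carry the factor
   0. *)
have predE : d%:R *: krawt d.-1 =
    d%:R *: ((1 + (r - 1) *: 'X) ^+ (D - d).+1 * (1 - 'X) ^+ d.-1).
  case: d le_dD {DE} => [|d] le_dD; first by rewrite !scale0r.
  by rewrite /krawt /= subnSK.
rewrite predE /krawt derivM !deriv_exp.
rewrite -[_ * _ *+ (D - d)]mulr_natl -[_ * _ *+ d]mulr_natl.
rewrite derivD derivB derivZ derivX -polyC1 derivC.
rewrite DE subnS; move: (D - d)%N => n {le_dD DE predE}.
rewrite -!mul_polyC; set p := (1%:P + _); set q := (1%:P - _).
have pE : p = 1 + (#|X|%:R - 1) * 'X by rewrite /p polyCB polyC_natr polyC1.
have qE : q = 1 - 'X by rewrite /q polyC1.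
clearbody p q.
rewrite !(polyCD, polyCN, polyCM, polyC_natr, polyC1).
(* Separating the zero cases removes the predecessors from the exponents and leaves polynomial
   identities for [ring]. *)
case: n => [|n]; case: d => [|d] /=; rewrite ?exprS ?expr0 -?natr1.
all: try move: (p ^+ n) => p'.
all: try move: (q ^+ d) => q'.
all: rewrite ?pE ?qE; move: ('X : {poly C}) (#|X|%:R : {poly C}) => t rho.
all: ring.
Qed.

Lemma krawt_conj d : map_poly Num.conj (krawt d) = krawt d.
Proof.
rewrite rmorphM !rmorphXn rmorphD rmorphB /= rmorph1 map_polyX linearZ /= map_polyX.
by rewrite rmorphB rmorph1 rmorph_nat.
Qed.
End Krawtchouk.

(** * Explicit primitive idempotents *)

Section PrimitiveIdempotents.
Variables (C : numClosedFieldType) (D : nat) (X : finType).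
Hypothesis X_gt1 : (1 < #|X|)%N.
Local Notation r := (#|X|%:R : C).
Local Notation A1 := (dist_mx C D X 1).

Definition krawt_mx i : hmatrix C D X := hdm D X (fun d => r ^- D * (krawt C D X d)`_i).

Lemma rX_neq0 : r != 0.
Proof. by rewrite pnatr_eq0 -lt0n ltnW. Qed.

Lemma adj_mul_krawt i : A1 *m krawt_mx i = hamming_eigval C D X i *: krawt_mx i.
Proof.
rewrite [A1]dist_mx1E // adj_mul_hdm; apply/matrixP => a b; rewrite !mxE.
set d := hamm _ _; have le_dD : (d <= D)%N by apply: hamm_leq.
have := congr1 (fun p : {poly C} => p`_i) (krawt_recurrence C X le_dD).
rewrite !(coefD, coefN, coefZ) coefXM coef_deriv.
have -> : (if i == 0%N then 0 else (krawt C D X d)`_i.-1.+1 *+ i.-1.+1)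
          = (krawt C D X d)`_i *+ i by case: i.
rewrite -[_ *+ i]mulr_natl /hamming_eigval => rec.
transitivity (r ^- D * ((D%:R - d%:R) * (r - 1) * (krawt C D X d.+1)`_i
    + d%:R * (krawt C D X d.-1)`_i + d%:R * (r - 2) * (krawt C D X d)`_i)); first by ring.
by rewrite rec; ring.
Qed.

Lemma sum_krawt_mx : \sum_(i < D.+1) krawt_mx i = 1%:M.
Proof.
apply/matrixP => a b; rewrite summxE; under eq_bigr => i _ do rewrite mxE.
rewrite -mulr_sumr; set d := hamm _ _; have le_dD : (d <= D)%N by apply: hamm_leq.
have [sz _] := size_lead_krawt C X_gt1 le_dD.
have -> : \sum_(i < D.+1) (krawt C D X d)`_i = (krawt C D X d).[1].
  by rewrite horner_coef sz; apply: eq_bigr => i _; rewrite expr1n mulr1.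
rewrite krawt_horner1 // mulrCA mulVf ?expf_neq0 ?rX_neq0 // mulr1.
by rewrite mxE /d hamm_eq0 (inj_eq enum_val_inj).
Qed.

Lemma krawt_mx_adjoint i : ((krawt_mx i)^t* )%sesqui = krawt_mx i.
Proof.
apply/matrixP => a b; rewrite !mxE hamm_sym rmorphM; congr (_ * _).
  by rewrite fmorphV rmorphXn rmorph_nat.
by rewrite -[in RHS]krawt_conj coef_map.
Qed.

(** The [krawt_mx j] sum to the identity, map into the eigenspaces of A_1 and are self-adjoint; this
    identifies the [i]-th one as the orthogonal projection. *)
Lemma prim_idemE i : (i <= D)%N -> prim_idem C D X i = krawt_mx i.
Proof.
move=> le_iD; set P := krawt_mx i.
have A1tr : A1^T = A1 by rewrite dist_mxE // trmx_hdm.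
have PA j : krawt_mx j *m A1 = hamming_eigval C D X j *: krawt_mx j.
  by rewrite -[LHS]trmxK trmx_mul A1tr trmx_hdm -/(krawt_mx j) adj_mul_krawt linearZ /= trmx_hdm.
rewrite /prim_idem A1tr; set U := eigenspace _ _.
have UA : U *m A1 = hamming_eigval C D X i *: U by apply/eigenspaceP.
(* For [j] other than [i], [U *m krawt_mx j] is scaled by two different eigenvalues at once, so it
   is 0. *)
have UP : U *m P = U.
  have lt_iD : (i < D.+1)%N by [].
  rewrite -[RHS]mulmx1 -sum_krawt_mx mulmx_sumr (bigD1 (Ordinal lt_iD)) //=.
  rewrite big1 ?addr0 // => j neq_ji.
  have : hamming_eigval C D X j *: (U *m krawt_mx j) = hamming_eigval C D X i *: (U *m krawt_mx j).
    by rewrite scalemxAr -adj_mul_krawt mulmxA UA -scalemxAl.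
  move/eqP; rewrite -subr_eq0 -scalerBl scaler_eq0 => /orP[|/eqP //].
  have -> : hamming_eigval C D X j - hamming_eigval C D X i = r * (i%:R - j%:R).
    by rewrite /hamming_eigval; ring.
  rewrite mulf_eq0 (negPf rX_neq0).
  rewrite subr_eq0 eqr_nat => /eqP eq_ij.
  by case/eqP: neq_ji; apply: val_inj.
have P_sub : (P <= U)%MS by apply/eigenspaceP/PA.
(* As [P] is self-adjoint, [U *m P = U] makes the rows of [1%:M - P] orthogonal to [U]. *)
have P_orth : (1%:M - P) *m proj_ortho U = 0.
  apply: proj_ortho_0; apply/orthomx1P.
  rewrite mulmxBl mul1mx -{1}UP trmx_mul map_mxM krawt_mx_adjoint.
  by rewrite subrr.
rewrite -[proj_ortho U]mul1mx -[1%:M](subrK P) mulmxDl.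
by rewrite P_orth proj_ortho_id // add0r trmx_hdm.
Qed.

Lemma dual_dist_mxE (x : X) i : (i <= D)%N ->
  dual_dist_mx C D x i =
    diag_mx (\row_b (krawt C D X (hamm (base_vertex D x) (hval b)))`_i).
Proof.
move=> le_iD; congr diag_mx; apply/rowP => b; rewrite [LHS]mxE prim_idemE // !mxE.
by rewrite /hval enum_rankK mulrA mulfV ?mul1r // expf_neq0 ?rX_neq0.
Qed.

End PrimitiveIdempotents.

(** * Generation of T by A_1 and A*_1 *)

Section SubconstituentAlgebra.
Variables (C : numClosedFieldType) (D : nat) (X : finType) (x : X).
Hypothesis X_gt1 : (1 < #|X|)%N.
Local Notation r := (#|X|%:R : C).

(* With e the indicator of x and o the all-ones vector, this is
   p e e^T + q e o^T + s o e^T + t o o^T. *)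
Definition glmx (p q s t : C) : 'M[C]_#|X| :=
  \matrix_(i, j) (p * (i == enum_rank x)%:R * (j == enum_rank x)%:R
                  + q * (i == enum_rank x)%:R + s * (j == enum_rank x)%:R + t).

Lemma glmx_scale c p q s t : c *: glmx p q s t = glmx (c * p) (c * q) (c * s) (c * t).
Proof. by apply/matrixP => i j; rewrite !mxE; ring. Qed.

Lemma glmx_add p q s t p' q' s' t' :
  glmx p q s t + glmx p' q' s' t' = glmx (p + p') (q + q') (s + s') (t + t').
Proof. by apply/matrixP => i j; rewrite !mxE; ring. Qed.

(** The coefficients come from the inner products e^T e = 1, e^T o = 1 and o^T o = r. *)
Lemma glmx_mul p q s t p' q' s' t' :
  glmx p q s t *m glmx p' q' s' t' =
    glmx (p * (p' + s') + q * (p' + r * s')) (p * (q' + t') + q * (q' + r * t'))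
         (s * (p' + s') + t * (p' + r * s')) (s * (q' + t') + t * (q' + r * t')).
Proof.
apply/matrixP => i j; rewrite !mxE.
set u := (i == _)%:R; set v := (j == _)%:R.
transitivity (\sum_(k < #|X|) ((q * u + t) * (s' * v + t')
   + (k == enum_rank x)%:R * ((p * u + q * u + s + t) * (p' * v + q' + s' * v + t')
                               - (q * u + t) * (s' * v + t')))).
  by apply: eq_bigr => k _; rewrite !mxE -/u -/v; case: (k == _) => /=; ring.
rewrite big_split /= sum_delta sumr_const card_ord -mulr_natl; ring.
Qed.

(** The case [D = 1] of A*_1: diagonal, with entry [r - 1] at [x] and [- 1] elsewhere. *)
Definition dual_mx : 'M[C]_#|X| := glmx r 0 0 0 - 1%:M.

Lemma adj_mxE : adj_mx C X = glmx 0 0 0 1 - 1%:M.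
Proof. by apply/matrixP => i j; rewrite !mxE; ring. Qed.

Local Notation hx b := (hamm (base_vertex D x) (hval b)).

Lemma dual_entry (a b : 'I_#|hvertex D X|) k : dual_mx (vcoord a k) (vcoord b k) =
  (hval a k == hval b k)%:R * (if base_vertex D x k != hval b k then - 1 else r - 1).
Proof.
rewrite !mxE vcoord_eq !(inj_eq enum_rank_inj) ffunE [x == _]eq_sym.
have [->|neq_ab] := eqVneq (hval a k) (hval b k); first by case: (_ == x) => /=; ring.
case: (eqVneq (hval b k) x) => [bk|_] /=; last by ring.
by rewrite -bk (negPf neq_ab) /=; ring.
Qed.

(** At distance [d], the [D - d] agreeing coordinates contribute [r - 1] each and the others [- 1],
    in total r (D - d) - D. *)
Lemma dual_dist_mx1 : (0 < D)%N -> dual_dist_mx C D x 1 = sigma D dual_mx.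
Proof.
move=> D_gt0; rewrite dual_dist_mxE //; apply/matrixP => a b.
rewrite summxE [LHS]mxE [X in X *+ _]mxE.
under [RHS]eq_bigr => k _ do rewrite siteE dual_entry.
have [<-|neq_ab] := eqVneq a b.
  rewrite coef1_krawt ?hamm_leq // mulr1n.
  transitivity (\sum_(k < D) ((r - 1) + (base_vertex D x k != hval a k)%:R * - r)).
    rewrite big_split /= sumr_const card_ord -mulr_suml -natr_sum -hamm_sum -mulr_natl; ring.
  apply: eq_bigr => k _; rewrite eqxx mul1r.
  have -> : [forall j, (j != k) ==> (vcoord a j == vcoord a j)].
    by apply/forallP => j; rewrite eqxx implybT.
  by case: (_ != _) => /=; ring.
rewrite mulr0n big1 // => k _; case: eqP => [eq_k|]; last by rewrite !mul0r.
case: forallP => [eq_ab|]; last by rewrite mulr0.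
case/eqP: neq_ab; apply: vcoord_inj => j; apply/eqP.
by have := eq_ab j; case: eqP => [-> _|//]; rewrite vcoord_eq eq_k.
Qed.

Lemma dual_dist_mx_D : dual_dist_mx C D x D = tens (fun=> dual_mx).
Proof.
rewrite dual_dist_mxE //; apply/matrixP => a b; rewrite [LHS]mxE [X in X *+ _]mxE [RHS]mxE.
rewrite (eq_bigr _ (fun k _ => dual_entry a b k)).
have [<-|neq_ab] := eqVneq a b.
  rewrite mulr1n (size_lead_krawt C X_gt1 (hamm_leq _ _)).2.
  under [RHS]eq_bigr => k _ do rewrite eqxx mul1r.
  rewrite (bigID (fun k => base_vertex D x k != hval a k)) /= mulrC; congr (_ * _).
    rewrite (eq_bigr (fun=> - 1)) => [|k -> //].
    rewrite prodr_const /hamm; congr (_ ^+ _); apply: eq_card => k.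
    by rewrite !inE.
  rewrite (eq_bigr (fun=> r - 1)) => [|k /negPf -> //].
  rewrite prodr_const; congr (_ ^+ _); apply/eqP.
  rewrite -(eqn_add2l (hx a)) subnKC ?hamm_leq // /hamm.
  rewrite -[X in X == _](card_ord D) -(cardC [set k | base_vertex D x k != hval a k]).
  by rewrite eqn_add2l; apply/eqP/eq_card => k; rewrite !inE.
have /existsP[k /negPf neq_k] : [exists k, vcoord a k != vcoord b k].
  apply: contraNT neq_ab; rewrite negb_exists => /forallP eq_ab.
  by apply/eqP/vcoord_inj => k; have /negPn/eqP := eq_ab k.
by rewrite (bigD1 k) //= -vcoord_eq neq_k !mul0r.
Qed.

(** A*_1 takes distinct values on the [D + 1] distance levels from [x], so by interpolation every
    function of the level is a polynomial in it. *)
Lemma hamm_diag_ind (P : hmatrix C D X -> Prop) : (0 < D)%N ->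
  P 1%:M -> (forall c A B, P A -> P B -> P (c *: A + B)) ->
  (forall A, P A -> P (dual_dist_mx C D x 1 *m A)) ->
  forall phi : nat -> C, P (diag_mx (\row_b phi (hx b))).
Proof.
move=> D_gt0 P1 Plin PA; pose dg phi : hmatrix C D X := diag_mx (\row_b phi (hx b)).
have eq_dg phi psi : (forall d, (d <= D)%N -> phi d = psi d) -> dg phi = dg psi.
  by move=> eq_phi; congr diag_mx; apply/rowP => b; rewrite !mxE eq_phi ?hamm_leq.
pose th d := r * (D%:R - d%:R) - D%:R : C.
have th_inj d d' : d != d' -> th d - th d' != 0.
  move=> neq_d; have -> : th d - th d' = r * (d'%:R - d%:R) by rewrite /th; ring.
  by rewrite mulf_neq0 ?rX_neq0 // subr_eq0 eqr_nat eq_sym.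
have dual1 : dual_dist_mx C D x 1 = dg th.
  rewrite dual_dist_mxE //; congr diag_mx; apply/rowP => b.
  by rewrite !mxE coef1_krawt ?hamm_leq.
have dgM phi psi : dg phi *m dg psi = dg (fun d => phi d * psi d).
  by rewrite mulmx_diag; congr diag_mx; apply/rowP => b; rewrite !mxE.
have dgL c phi psi : c *: dg phi + dg psi = dg (fun d => c * phi d + psi d).
  by apply/matrixP => a b; rewrite !mxE mulrnAr -mulrnDl.
have dg1 : dg (fun=> 1) = 1%:M.
  by rewrite -[RHS]diag_const_mx; congr diag_mx; apply/rowP => b; rewrite !mxE.
pose lag n d := \prod_(j < n) (th d - th j).
have Plag n : P (dg (lag n)).
  elim: n => [|n IHn].
    by rewrite (eq_dg _ (fun=> 1)) ?dg1 // => d _; rewrite /lag big_ord0.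
  have -> : dg (lag n.+1) = - th n *: dg (lag n) + dual_dist_mx C D x 1 *m dg (lag n).
    by rewrite dual1 dgM dgL; apply: eq_dg => d _; rewrite /lag big_ord_recr /=; ring.
  by apply: Plin => //; apply: PA.
(* Newton interpolation at the nodes th 0, ..., th (n - 1). *)
have interp n phi : exists2 psi, P (dg psi) & forall d, (d < n)%N -> psi d = phi d.
  elim: n => [|n [psi Ppsi psiE]]; first by exists (fun=> 1); rewrite ?dg1.
  exists (fun d => (phi n - psi n) / lag n n * lag n d + psi d).
    by rewrite -dgL; apply: Plin.
  have lag_neq0 : lag n n != 0.
    by rewrite prodf_seq_neq0; apply/allP => j _; apply/implyP => _; rewrite th_inj // gtn_eqF.
  move=> d; rewrite ltnS leq_eqVlt => /orP[/eqP ->|lt_dn]; first by rewrite divfK // subrK.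
  have -> : lag n d = 0 by rewrite /lag (bigD1 (Ordinal lt_dn)) //= subrr mul0r.
  by rewrite mulr0 add0r psiE.
move=> phi; have [psi Ppsi psiE] := interp D.+1 phi.
by rewrite -/(dg phi) (eq_dg _ psi) // => d le_dD; rewrite psiE.
Qed.

Lemma subconst_alg_ind2 (P : hmatrix C D X -> Prop) : (0 < D)%N ->
  P 1%:M -> (forall c A B, P A -> P B -> P (c *: A + B)) ->
  (forall A B, P A -> P B -> P (A *m B)) ->
  P (dist_mx C D X 1) -> P (dual_dist_mx C D x 1) ->
  forall A, subconst_alg x A -> P A.
Proof.
move=> D_gt0 P1 Plin Pmul PA1 PB1 A.
have P0 : P 0 by have := Plin (-1) _ _ P1 P1; rewrite scaleN1r addNr.
elim=> {A} [i _|i le_iD||c A _ PA|A B _ PA _ PB|A B _ PA _ PB].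
- by apply: dist_mx_ind => // M PM; apply: Pmul.
- rewrite dual_dist_mxE //; exact: (hamm_diag_ind D_gt0 P1 Plin (fun M => Pmul _ M PB1)
    (fun d => (krawt C D X d)`_i)).
- exact: P1.
- by have := Plin c _ _ PA P0; rewrite addr0.
- by have := Plin 1 _ _ PA PB; rewrite scale1r.
- exact: Pmul.
Qed.

End SubconstituentAlgebra.

(** * The commutator of A_D and A*_D on weight vectors *)

Section Commutator.
Variables (C : numClosedFieldType) (D : nat) (X : finType) (x : X).
Hypothesis X_gt2 : (2 < #|X|)%N.
Local Notation r := (#|X|%:R : C).
Local Notation smatrix := 'M[C]_#|X|.
Local Notation gl := (glmx x).

Let X_gt1 : (1 < #|X|)%N := ltnW X_gt2.

Lemma r1_neq0 : r - 1 != 0.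
Proof. by rewrite subr_eq0 pnatr_eq1 gtn_eqF. Qed.

(* The projections onto e and onto o along the other one, on the span of e and o;
   both vanish on the orthogonal complement. *)
Definition proj_pos : smatrix := gl (r / (r - 1)) (- (r - 1)^-1) 0 0.
Definition proj_neg : smatrix := gl 0 0 (- (r - 1)^-1) (r - 1)^-1.
Definition cartan_mx : smatrix := proj_pos - proj_neg.

(** Indices 0, 1, 2 stand for the weights -1, 0, 1 of [cartan_mx]; the middle projection has the
    orthogonal complement of e and o as its image. *)
Definition proj3 (i : 'I_3) : smatrix :=
  if i == 0 then proj_neg else if i == 1 then 1%:M - proj_pos - proj_neg else proj_pos.
Definition wt3 (i : 'I_3) : int := i%:Z - 1.

Lemma sum_proj3 : \sum_i proj3 i = 1%:M.
Proof.
rewrite !big_ord_recl big_ord0 /proj3 /=; apply/matrixP => i j; rewrite !mxE; ring.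
Qed.

Lemma proj_mul : [/\ proj_pos *m proj_pos = proj_pos, proj_neg *m proj_neg = proj_neg,
  proj_pos *m proj_neg = 0 & proj_neg *m proj_pos = 0].
Proof.
have := r1_neq0; rewrite /proj_pos /proj_neg !glmx_mul => nz.
by split; apply/matrixP => i j; rewrite !mxE; field.
Qed.

Lemma cartan_proj3 i :
  cartan_mx *m proj3 i = (wt3 i)%:~R *: proj3 i /\
  proj3 i *m cartan_mx = (wt3 i)%:~R *: proj3 i.
Proof.
have [pp nn pn np] := proj_mul; rewrite /cartan_mx /proj3 /wt3.
case: i => -[|[|[|//]]] /= lt_i.
- by rewrite mulmxBl mulmxBr nn pn np sub0r scaleN1r.
- by rewrite !(mulmxBl, mulmxBr, mulmx1, mul1mx) nn pn np pp scale0r; split;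
    apply/matrixP => ? ?; rewrite !mxE; ring.
- by rewrite mulmxBl mulmxBr pp pn np subr0 scale1r.
Qed.

(** The one-factor eigenvalues, in the inverse-free form a a* = c a* a. *)
Lemma commutator_proj3 i : (adj_mx C X *m dual_mx C x) *m proj3 i =
  (1 - r) ^ wt3 i *: ((dual_mx C x *m adj_mx C X) *m proj3 i).
Proof.
have nz := r1_neq0; have nz' : 1 - r != 0 by rewrite -opprB oppr_eq0.
rewrite (adj_mxE C x) /dual_mx /proj3 /wt3.
rewrite !(mulmxBl, mulmxBr, mulmx1, mul1mx) !glmx_mul.
case: i => -[|[|[|//]]] /= lt_i; rewrite /proj_pos /proj_neg;
  rewrite ?(mulmxBl, mulmxBr, mulmx1, mul1mx, glmx_mul);
  apply/matrixP => a b; rewrite !mxE.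
- rewrite sub0r exprN1; field.
  by rewrite nz nz'.
- by rewrite subrr expr0z mul1r; field.
- by rewrite expr1z; field.
Qed.

Lemma adj_tens_unit : dist_mx C D X D \in unitmx.
Proof.
rewrite dist_mx_D // (adj_mxE C x).
(* With J = o o^T, the relation J^2 = r J makes J / (r - 1) - 1 the inverse of J - 1. *)
have inv : (gl 0 0 0 1 - 1%:M) *m (gl 0 0 0 (r - 1)^-1 - 1%:M) = 1%:M.
  rewrite mulmxBl !mulmxBr !mul1mx mulmx1 glmx_mul; have := r1_neq0.
  by move=> nz; apply/matrixP => i j; rewrite !mxE; field.
have /mulmx1_unit[] // : tens (fun=> gl 0 0 0 1 - 1%:M) *m
    tens (fun=> gl 0 0 0 (r - 1)^-1 - 1%:M) = 1%:M :> hmatrix C D X.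
by rewrite tens_mul -(tens1 C D X); apply: eq_tens => k.
Qed.

Lemma dual_tens_unit : dual_dist_mx C D x D \in unitmx.
Proof.
rewrite dual_dist_mx_D // /dual_mx.
have inv : (gl r 0 0 0 - 1%:M) *m (gl (r / (r - 1)) 0 0 0 - 1%:M) = 1%:M.
  rewrite mulmxBl !mulmxBr !mul1mx mulmx1 glmx_mul; have := r1_neq0.
  by move=> nz; apply/matrixP => i j; rewrite !mxE; field.
have /mulmx1_unit[] // : tens (fun=> gl r 0 0 0 - 1%:M) *m
    tens (fun=> gl (r / (r - 1)) 0 0 0 - 1%:M) = 1%:M :> hmatrix C D X.
by rewrite tens_mul -(tens1 C D X); apply: eq_tens => k.
Qed.

Definition proj_seq (s : {ffun 'I_D -> 'I_3}) : hmatrix C D X :=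
  tens (fun k => proj3 (s k)).
Definition wt_seq (s : {ffun 'I_D -> 'I_3}) : int := \sum_k wt3 (s k).

Lemma sum_proj_seq : \sum_s proj_seq s = 1%:M.
Proof. by rewrite sum_tens sum_proj3 tens1. Qed.

Lemma cartan_proj_seq s :
  sigma D cartan_mx *m proj_seq s = (wt_seq s)%:~R *: proj_seq s /\
  proj_seq s *m sigma D cartan_mx = (wt_seq s)%:~R *: proj_seq s.
Proof.
have scaleE k : tens (fun j => (if j == k then (wt3 (s j))%:~R else 1) *: proj3 (s j)) =
    (wt3 (s k))%:~R *: proj_seq s.
  rewrite tens_scale; congr (_ *: _); rewrite (bigD1 k) //= eqxx big1 ?mulr1 //.
  by move=> j /negPf ->.
rewrite /wt_seq rmorph_sum scaler_suml mulmx_suml mulmx_sumr.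
split; apply: eq_bigr => k _; rewrite -scaleE; [rewrite site_tens|rewrite tens_site];
  apply: eq_tens => j; have [l1 l2] := cartan_proj3 (s j);
  by case: (j == k); rewrite ?scale1r.
Qed.

(** The [proj_seq s] split [v] into joint components. Those of total weight other than [m] vanish,
    and on the rest the one-factor scalars multiply to [(1 - r) ^ m]. *)
Lemma D_commutator_eigenvector (v : hvector C D X) (m : int) :
  sigma D cartan_mx *m v = m%:~R *: v ->
  D_commutator C D x *m v = (1 - r) ^ m *: v.
Proof.
move=> Kv; set A := dist_mx C D X D; set B := dual_dist_mx C D x D.
have nz' : 1 - r != 0 by rewrite -opprB oppr_eq0 r1_neq0.
suff AB : A *m B *m v = (1 - r) ^ m *: (B *m A *m v).
  rewrite /D_commutator -/A -/B -!mulmxA (mulmxA A) AB -!scalemxAr -!mulmxA.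
  by rewrite (mulKmx dual_tens_unit) (mulKmx adj_tens_unit).
have component s : A *m B *m proj_seq s = (1 - r) ^ wt_seq s *: (B *m A *m proj_seq s).
  rewrite /A /B dist_mx_D // dual_dist_mx_D // !tens_mul.
  rewrite (eq_tens (fun k => commutator_proj3 (s k))) tens_scale; congr (_ *: _).
  rewrite /wt_seq; elim/big_rec2: _ => [|k y z _ ->]; first by rewrite expr0z.
  by rewrite -expfzDr.
have vanish s : wt_seq s != m -> proj_seq s *m v = 0.
  move=> neq_wt; have /eqP : (wt_seq s)%:~R *: (proj_seq s *m v) = m%:~R *: (proj_seq s *m v).
    by rewrite scalemxAl -(cartan_proj_seq s).2 -mulmxA Kv scalemxAr.
  by rewrite -subr_eq0 -scalerBl scaler_eq0 subr_eq0 eqr_int (negPf neq_wt) => /eqP.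
rewrite -[v]mul1mx -sum_proj_seq mulmx_suml !mulmx_sumr scaler_sumr.
apply: eq_bigr => s _; have [<-|neq_wt] := eqVneq (wt_seq s) m.
  by rewrite !mulmxA component -scalemxAl.
by rewrite vanish // !mulmx0 scaler0.
Qed.

End Commutator.

(** * Irreducible T-modules as irreducible sl_2-modules *)

Section Modules.
Variables (C : numClosedFieldType) (D : nat) (X : finType) (x : X).
Hypothesis D_gt0 : (0 < D)%N.
Hypothesis X_gt2 : (2 < #|X|)%N.
Local Notation r := (#|X|%:R : C).
Local Notation smatrix := 'M[C]_#|X|.
Local Notation gl := (@glmx C X x).
Local Notation sg t := (sigma D t).

Let X_gt1 : (1 < #|X|)%N := ltnW X_gt2.

Lemma dist1_sigma : dist_mx C D X 1 = sg (gl 0 0 0 1) - D%:R%:M.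
Proof. by rewrite dist_mx1E // (adj_mxE C x) linearB /= sigma1. Qed.

Lemma dual1_sigma : dual_dist_mx C D x 1 = r *: sg (gl 1 0 0 0) - D%:R%:M.
Proof.
rewrite dual_dist_mx1 // /dual_mx linearB /= sigma1 -linearZ /= glmx_scale.
by rewrite mulr1 mulr0.
Qed.

Lemma subconst_sub (A B : hmatrix C D X) :
  subconst_alg x A -> subconst_alg x B -> subconst_alg x (A - B).
Proof.
by move=> hA hB; apply: subconst_add => //; rewrite -scaleN1r; apply: subconst_scale.
Qed.

Lemma subconst_scalar (c : C) : subconst_alg x (c%:M : hmatrix C D X).
Proof. by rewrite -scalemx1; apply/subconst_scale/subconst_one. Qed.

Lemma subconst_sigma_commutator (s t : smatrix) : subconst_alg x (sg s) -> subconst_alg x (sg t) ->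
  subconst_alg x (sg (s *m t - t *m s)).
Proof.
by move=> hs ht; rewrite -sigma_commutator; apply: subconst_sub; apply: subconst_mul.
Qed.

(** A*_1 and A_1 give e e^T and o o^T, and commutators supply the two missing directions. *)
Lemma subconst_glmx (p q s t : C) : subconst_alg x (sg (gl p q s t)).
Proof.
have r_neq0 := rX_neq0 C X_gt1.
have ee : subconst_alg x (sg (gl 1 0 0 0)).
  have -> : sg (gl 1 0 0 0) = r^-1 *: (dual_dist_mx C D x 1 + D%:R%:M).
    by rewrite dual1_sigma subrK scalerA mulVf // scale1r.
  apply/subconst_scale/subconst_add; last exact: subconst_scalar.
  exact: subconst_dual_dist.
have oo : subconst_alg x (sg (gl 0 0 0 1)).
  have -> : sg (gl 0 0 0 1) = dist_mx C D X 1 + D%:R%:M by rewrite dist1_sigma subrK.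
  apply: subconst_add; last exact: subconst_scalar.
  exact: subconst_dist.
have comm1 := subconst_sigma_commutator ee oo.
have comm2 := subconst_sigma_commutator ee comm1.
set c1 := _ - _ in comm1; set c2 := _ - _ in comm2.
(* [c1] is e o^T - o e^T, and [c2] is e o^T + o e^T - 2 e e^T. *)
have -> : gl p q s t = (p + q + s) *: gl 1 0 0 0 + t *: gl 0 0 0 1
                      + ((q - s) / 2) *: c1 + ((q + s) / 2) *: c2.
  rewrite /c2 /c1 !(mulmxBl, mulmxBr) !glmx_mul.
  by apply/matrixP => i j; rewrite !mxE; field.
clearbody c1 c2; rewrite !linearD !linearZ /=.
by do 3?[apply: subconst_add]; apply: subconst_scale.
Qed.

(* On the span of e and o, raise_mx sends o to e and kills e, and lower_mx sends e
   to o and kills o.  The primed matrices form with raise_mx a second sl_2-triple,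
   chosen so that 2 e e^T = support_mx + cartan'_mx: as support_mx acts on W as a
   scalar, the weight spaces of cartan'_mx in W are eigenspaces of A*_1. *)
Definition support_mx : smatrix := proj_pos C x + proj_neg C x.
Definition raise_mx : smatrix := gl (- (r - 1)^-1) (r - 1)^-1 0 0.
Definition lower_mx : smatrix := gl 0 0 (r / (r - 1)) (- (r - 1)^-1).
Definition lower'_mx : smatrix := gl (- 1) 0 1 0.
Definition cartan'_mx : smatrix := 2 *: gl 1 0 0 0 - support_mx.

Let r1_neq0' := r1_neq0 C X_gt2.

Lemma sl2_triple :
  [/\ raise_mx *m lower_mx - lower_mx *m raise_mx = cartan_mx C x,
      cartan_mx C x *m raise_mx - raise_mx *m cartan_mx C x = 2 *: raise_mx
    & cartan_mx C x *m lower_mx - lower_mx *m cartan_mx C x = - 2 *: lower_mx].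
Proof.
rewrite /cartan_mx /proj_pos /proj_neg /raise_mx /lower_mx.
rewrite !(mulmxBl, mulmxBr) !glmx_mul.
by split; apply/matrixP => i j; rewrite !mxE; field.
Qed.

Lemma sl2_triple' :
  [/\ raise_mx *m lower'_mx - lower'_mx *m raise_mx = cartan'_mx,
      cartan'_mx *m raise_mx - raise_mx *m cartan'_mx = 2 *: raise_mx
    & cartan'_mx *m lower'_mx - lower'_mx *m cartan'_mx = - 2 *: lower'_mx].
Proof.
rewrite /cartan'_mx /support_mx /proj_pos /proj_neg /raise_mx /lower'_mx.
rewrite !(mulmxBl, mulmxBr, mulmxDl, mulmxDr) -?scalemxAl -?scalemxAr !glmx_mul.
by split; apply/matrixP => i j; rewrite !mxE; field.
Qed.

(** [support_mx] is the orthogonal projection onto the span of e and o, hence a two-sided identity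
    for the matrices [glmx]. *)
Lemma support_central p q s t :
  support_mx *m gl p q s t = gl p q s t *m support_mx.
Proof.
rewrite /support_mx /proj_pos /proj_neg glmx_add !glmx_mul.
by apply/matrixP => i j; rewrite !mxE; field.
Qed.

Lemma sigma_support_central A :
  subconst_alg x A -> sg support_mx *m A = A *m sg support_mx.
Proof.
have comm p q s t : sg support_mx *m sg (gl p q s t) = sg (gl p q s t) *m sg support_mx.
  by apply/subr0_eq; rewrite sigma_commutator support_central subrr linear0.
move: A; apply: (subconst_alg_ind2 X_gt1
  (P := fun A => sg support_mx *m A = A *m sg support_mx) D_gt0).
- by rewrite mulmx1 mul1mx.
- by move=> c M N hM hN; rewrite mulmxDr mulmxDl -scalemxAr hM hN scalemxAl.
- by move=> M N hM hN; rewrite mulmxA hM -mulmxA hN mulmxA.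
- by rewrite dist1_sigma mulmxBr mulmxBl comm scalar_mxC.
- by rewrite dual1_sigma mulmxBr mulmxBl -scalemxAr comm -scalemxAl scalar_mxC.
Qed.

Variable W : {vspace hvector C D X}.
Hypothesis W_irr : irreducible_Tmodule x W.

Lemma Tmodule_mem (U : {vspace hvector C D X}) B v :
  is_Tmodule x U -> subconst_alg x B -> v \in U -> B *m v \in U.
Proof.
move=> U_mod hB Uv; have /subvP := U_mod B hB; apply.
by have := memv_img (lmul_end B) Uv; rewrite lfunE.
Qed.

Lemma TmoduleP (U : {vspace hvector C D X}) :
  (forall B, subconst_alg x B -> forall v, v \in U -> B *m v \in U) -> is_Tmodule x U.
Proof.
move=> hU B hB; apply/subvP => _ /memv_imgP[v Uv ->]; rewrite lfunE.
exact: hU.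
Qed.

Lemma action_onE B (w : subvs_of W) : subconst_alg x B ->
  vsval (action_on W B w) = B *m vsval w.
Proof.
move=> hB; rewrite lfunE /= lfunE /= vsprojK //.
have [W_mod _ _] := W_irr; apply: Tmodule_mem => //; exact: subvsP.
Qed.

Lemma dim_subvs : \dim {:subvs_of W} = \dim W.
Proof. by rewrite dimvf. Qed.

Lemma dim_W_gt0 : (0 < \dim {:subvs_of W})%N.
Proof. by have [_ W_neq0 _] := W_irr; rewrite dim_subvs lt0n dimv_eq0. Qed.

(** Schur's lemma: an eigenspace in [W] of an element commuting with T is a nonzero submodule. *)
Lemma support_scalar : exists psi, forall v, v \in W -> sg support_mx *m v = psi *: v.
Proof.
have [W_mod _ W_min] := W_irr.
have hp : subconst_alg x (sg support_mx).
  by rewrite /support_mx /proj_pos /proj_neg glmx_add; apply: subconst_glmx.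
have [psi [w [w_neq0 pw]]] := exists_eigenvector (action_on W (sg support_mx)) dim_W_gt0.
exists psi; pose U := (W :&: passmx.leigenspace (lmul_end (sg support_mx)) psi)%VS.
have UP v : (v \in U) = (v \in W) && (sg support_mx *m v == psi *: v).
  by rewrite memv_cap mem_leigenspace lfunE.
have [||U0|UW v] := W_min U.
- apply: TmoduleP => B hB v; rewrite !UP => /andP[Wv /eqP pv].
  by rewrite Tmodule_mem // mulmxA sigma_support_central // -mulmxA pv scalemxAr eqxx.
- exact: capvSl.
- have : vsval w \in U by rewrite UP subvsP -action_onE // pw linearZ eqxx.
  rewrite U0 memv0 => /eqP w0; case/eqP: w_neq0; apply: val_inj.
  by rewrite [LHS]w0.
- by rewrite -{1}UW UP => /andP[_ /eqP].
Qed.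

(** On [W] the support acts as a scalar, and [cartan_mx] comes from the commutator of raising and
    lowering. So a subspace stable under these two is stable under A_1 and A*_1, hence under T. *)
Lemma sl2_irreducible (U : {vspace hvector C D X}) : (U <= W)%VS ->
  (forall v, v \in U -> sg raise_mx *m v \in U) ->
  (forall v, v \in U -> sg lower_mx *m v \in U) -> U = 0%VS \/ U = W.
Proof.
have [W_mod _ W_min] := W_irr; have [psi psiE] := support_scalar.
move=> UW hE hF; apply: W_min => //; apply: TmoduleP.
pose stab (B : hmatrix C D X) := forall v, v \in U -> B *m v \in U.
have stab_scalar c : stab c%:M by move=> v Uv; rewrite mul_scalar_mx memvZ.
have stab_lin c A B : stab A -> stab B -> stab (c *: A + B).
  by move=> hA hB v Uv; rewrite mulmxDl -scalemxAl memvD ?memvZ ?hA ?hB.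
have stab_mul A B : stab A -> stab B -> stab (A *m B).
  by move=> hA hB v Uv; rewrite -mulmxA hA ?hB.
have stabK : stab (sg (cartan_mx C x)).
  have [<- _ _] := sl2_triple; rewrite -sigma_commutator addrC -scaleN1r.
  by apply: stab_lin; apply: stab_mul.
have stabp : stab (sg support_mx).
  by move=> v Uv; rewrite psiE ?memvZ //; apply: (subvP UW).
have stab_sg c s t : stab (sg s) -> stab (sg t) -> stab (sg (c *: s + t)).
  by move=> hs ht; rewrite linearP; apply: stab_lin.
have stab_shift A c : stab A -> stab (A - c%:M).
  by move=> hA v Uv; rewrite mulmxBl memvB ?hA ?stab_scalar.
apply: (subconst_alg_ind2 X_gt1 (P := stab) D_gt0).
- exact: stab_scalar.
- exact: stab_lin.
- exact: stab_mul.
- rewrite dist1_sigma.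
  (* The multiples of [cartan_mx] and [support_mx] add up to [r] times [proj_neg]: o o^T sends o to
     r o, and e to o. *)
  have -> : gl 0 0 0 1 = - (r / 2) *: cartan_mx C x + ((r / 2) *: support_mx + lower_mx).
    rewrite /cartan_mx /support_mx /proj_pos /proj_neg /lower_mx.
    by apply/matrixP => i j; rewrite !mxE; field.
  by apply: stab_shift; apply: (stab_sg) => //; apply: (stab_sg).
- rewrite dual1_sigma.
  (* Likewise e e^T is [proj_pos] plus [raise_mx], as it sends both e and o to e. *)
  have -> : gl 1 0 0 0 = 2^-1 *: cartan_mx C x + (2^-1 *: support_mx + raise_mx).
    rewrite /cartan_mx /support_mx /proj_pos /proj_neg /raise_mx.
    by apply/matrixP => i j; rewrite !mxE; field.
  apply: stab_shift => v Uv; rewrite -scalemxAl memvZ //.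
  by move: v Uv; apply: (stab_sg) => //; apply: (stab_sg).
Qed.

End Modules.

(** * Transfer of sl_2 theory to an irreducible module *)

Section Weights.
Variables (C : numClosedFieldType) (D : nat) (X : finType) (x : X).
Hypothesis D_gt0 : (0 < D)%N.
Hypothesis X_gt2 : (2 < #|X|)%N.
Variable W : {vspace hvector C D X}.
Hypothesis W_irr : irreducible_Tmodule x W.
Local Notation r := (#|X|%:R : C).
Local Notation sg t := (sigma D t).

Lemma sigma_weight_basis (E F H : 'M[C]_#|X|) :
  subconst_alg x (sg E) -> subconst_alg x (sg F) -> subconst_alg x (sg H) ->
  E *m F - F *m E = H -> H *m E - E *m H = 2 *: E -> H *m F - F *m H = - 2 *: F ->
  (forall U : {vspace hvector C D X}, (U <= W)%VS ->
    (forall v, v \in U -> sg E *m v \in U) ->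
    (forall v, v \in U -> sg F *m v \in U) -> U = 0%VS \/ U = W) ->
  exists n (w : nat -> subvs_of W), basis_of fullv (mkseq w n.+1) /\
    forall i, (i < n.+1)%N ->
      sg H *m vsval (w i) = (n%:R - i.*2%:R) *: vsval (w i).
Proof.
move=> hE hF hH EF HE HF irr.
have actE := action_onE W_irr.
have comm s t u c (hs : subconst_alg x (sg s)) (ht : subconst_alg x (sg t))
    (hu : subconst_alg x (sg u)) : s *m t - t *m s = c *: u -> forall w : subvs_of W,
    action_on W (sg s) (action_on W (sg t) w) - action_on W (sg t) (action_on W (sg s) w)
      = c *: action_on W (sg u) w.
  move=> st w; apply: subvs_inj; rewrite linearB linearZ /= !actE // !mulmxA -mulmxBl.
  by rewrite sigma_commutator st linearZ -scalemxAl.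
have [||||U hUE hUF|n [w [w_basis wH]]] := @sl2_weight_basis C (subvs_of W)
    (action_on W (sg E)) (action_on W (sg F)) (action_on W (sg H)).
- exact: (dim_W_gt0 W_irr).
- by move=> w; rewrite (comm _ _ H 1) ?scale1r.
- by move=> w; rewrite (comm _ _ E 2).
- by move=> w; rewrite (comm _ _ F (- 2)).
(* A subspace [U] of [subvs_of W] is replaced by its image in the ambient space, where the
   irreducibility hypothesis is stated. *)
- have stab s : subconst_alg x (sg s) ->
      (forall u, u \in U -> action_on W (sg s) u \in U) ->
      forall v, v \in (linfun vsval @: U)%VS -> sg s *m v \in (linfun vsval @: U)%VS.
    move=> hs hU _ /memv_imgP[u Uu ->]; rewrite lfunE /= -actE //.
    by have := memv_img (linfun vsval) (hU u Uu); rewrite lfunE.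
  have memU u : (u \in U) = (vsval u \in (linfun vsval @: U)%VS).
    apply/idP/memv_imgP => [Uu|[u' Uu' eq_u]]; first by exists u; rewrite ?lfunE.
    by move: eq_u; rewrite lfunE /= => /val_inj ->.
  have [|||U0|UW] := irr (linfun vsval @: U)%VS.
  + by apply/subvP => _ /memv_imgP[u _ ->]; rewrite lfunE subvsP.
  + exact: stab.
  + exact: stab.
  + left; apply/eqP; rewrite -subv0; apply/subvP => u; rewrite memU U0 !memv0 => /eqP u0.
    by apply/eqP/val_inj; rewrite [LHS]u0.
  + by right; apply/vspaceP => u; rewrite memU UW subvsP memvf.
- exists n, w; split=> // i lt_in.
  by rewrite -actE // wH // linearZ.
Qed.

End Weights.

(** * Weight bases of the two Cartan elements, and the diameter *)

Section Spectrum.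
Variables (C : numClosedFieldType) (D : nat) (X : finType) (x : X).
Hypothesis D_gt0 : (0 < D)%N.
Hypothesis X_gt2 : (2 < #|X|)%N.
Variable W : {vspace hvector C D X}.
Hypothesis W_irr : irreducible_Tmodule x W.
Local Notation r := (#|X|%:R : C).
Local Notation sg t := (sigma D t).

Let X_gt1 : (1 < #|X|)%N := ltnW X_gt2.

Lemma cartan_weight_basis : exists (w : nat -> subvs_of W),
  basis_of fullv (mkseq w (\dim W)) /\
  forall i, (i < \dim W)%N ->
    sg (cartan_mx C x) *m vsval (w i) = ((\dim W).-1%:R - i.*2%:R) *: vsval (w i).
Proof.
have [EF HE HF] := sl2_triple C x X_gt2.
have [||||n [w [w_basis wK]]] := sigma_weight_basis W_irr _ _ _ EF HE HF.
- exact: subconst_glmx.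
- exact: subconst_glmx.
- by rewrite -EF; apply: subconst_sigma_commutator; apply: subconst_glmx.
- exact: sl2_irreducible.
have dimW : \dim W = n.+1.
  rewrite -dim_subvs; have /andP[/eqP <-] := w_basis.
  by rewrite /free size_mkseq => /eqP.
by exists w; rewrite dimW.
Qed.

Lemma cartan'_weight_basis : exists (w : nat -> subvs_of W),
  basis_of fullv (mkseq w (\dim W)) /\
  forall i, (i < \dim W)%N ->
    sg (cartan'_mx C x) *m vsval (w i) = ((\dim W).-1%:R - i.*2%:R) *: vsval (w i).
Proof.
have [EF HE HF] := sl2_triple' C x X_gt2.
have [|||U UW hE hF|n [w [w_basis wK]]] := sigma_weight_basis W_irr _ _ _ EF HE HF.
- exact: subconst_glmx.
- exact: subconst_glmx.
- by rewrite -EF; apply: subconst_sigma_commutator; apply: subconst_glmx.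
- apply: (sl2_irreducible D_gt0 X_gt2 W_irr) => // v Uv.
  (* [lower_mx] equals [lower'_mx - raise_mx + cartan'_mx], so irreducibility passes to the primed
     triple. *)
  have -> : sg (lower_mx C x) = sg (lower'_mx C x) - sg (raise_mx C x)
      + (sg (raise_mx C x) *m sg (lower'_mx C x) - sg (lower'_mx C x) *m sg (raise_mx C x)).
    rewrite sigma_commutator -linearB -linearD EF; congr (sigma _ _).
    rewrite /lower_mx /lower'_mx /raise_mx /cartan'_mx /support_mx /proj_pos /proj_neg.
    have nz := r1_neq0 C X_gt2.
    by apply/matrixP => i j; rewrite !mxE; field.
  rewrite mulmxDl !mulmxBl -!mulmxA.
  by apply: memvD; apply: memvB; do 3?[exact: Uv | apply: hE | apply: hF].
have dimW : \dim W = n.+1.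
  rewrite -dim_subvs; have /andP[/eqP <-] := w_basis.
  by rewrite /free size_mkseq => /eqP.
by exists w; rewrite dimW.
Qed.

(** Each weight vector of [cartan'_mx] is supported on one distance level from [x], and different
    ones on different levels; so exactly [\dim W] of the E*_i W are nonzero. *)
Lemma diameter_dim : Tmodule_diameter x W = (\dim W).-1.
Proof.
have [w [w_basis wH]] := cartan'_weight_basis.
have [psi psiE] := support_scalar D_gt0 X_gt2 W_irr.
set n := \dim W in w_basis wH *.
pose h (a : 'I_#|hvertex D X|) := hamm (base_vertex D x) (hval a).
have r_neq0 := rX_neq0 C X_gt1.
have w_neq0 i : (i < n)%N -> vsval (w i) != 0.
  move=> lt_in; have : w i != 0.
    by apply: (free_not0 (basis_free w_basis)); apply/mapP; exists i; rewrite ?mem_iota.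
  by apply: contra_neq => w0; apply: val_inj; rewrite [LHS]w0.
(* [w i] is an eigenvector of the diagonal matrix A*_1, so at a nonzero coordinate [a] the diagonal
   entry r (D - h a) - D is the eigenvalue. *)
have level i a : (i < n)%N -> vsval (w i) a 0 != 0 ->
    D%:R - (h a)%:R = (psi + (n.-1%:R - i.*2%:R)) / 2.
  move=> lt_in wa; set v := vsval (w i) in wa *.
  have : dual_dist_mx C D x 1 *m v = (r * ((psi + (n.-1%:R - i.*2%:R)) / 2) - D%:R) *: v.
    have eeE : glmx x 1 0 0 0 = 2^-1 *: (support_mx C x + cartan'_mx C x).
      by rewrite /cartan'_mx addrC subrK scalerA mulVf ?scale1r // pnatr_eq0.
    rewrite dual1_sigma // eeE mulmxBl mul_scalar_mx -scalemxAl linearZ linearD /=.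
    rewrite -scalemxAl mulmxDl psiE ?subvsP // wH // -scalerDl !scalerA -scalerBl.
    by congr ((_ - _) *: _); ring.
  move=> /matrixP/(_ a 0); rewrite dual_dist_mxE // mul_diag_mx !mxE coef1_krawt ?hamm_leq //.
  by move=> /(mulIf wa)/(addIr _)/(mulfI r_neq0).
have [k kP] : exists k : 'I_n -> 'I_D.+1, forall i : 'I_n,
    (exists2 a, vsval (w i) a 0 != 0 & h a = k i) /\
    forall a, vsval (w i) a 0 != 0 -> h a = k i.
  have := @fin_all_exists _ (fun=> 'I_D.+1) (fun (i : 'I_n) (l : 'I_D.+1) =>
    (exists2 a, vsval (w i) a 0 != 0 & h a = l) /\
    forall a, vsval (w i) a 0 != 0 -> h a = l); apply=> i.
  have [a wa] : exists a, vsval (w i) a 0 != 0.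
    apply/existsP; apply: contraNT (w_neq0 i (ltn_ord i)).
    rewrite negb_exists => /forallP w0.
    by apply/eqP/matrixP => a b; rewrite ord1 mxE; have /negPn/eqP := w0 a.
  have lt_hD : (h a < D.+1)%N by rewrite ltnS hamm_leq.
  exists (Ordinal lt_hD); split=> [|b wb]; first by exists a.
  have := level i b (ltn_ord i) wb.
  rewrite -(level i a (ltn_ord i) wa) => /(addrI _)/oppr_inj/eqP.
  by rewrite eqr_nat => /eqP.
have k_inj : injective k.
  move=> i j eq_k; have [[a wa ha] _] := kP i; have [[b wb hb] _] := kP j.
  have := level i a (ltn_ord i) wa; rewrite ha eq_k -hb (level j b (ltn_ord j) wb).
  have half_neq0 : 2^-1 != 0 :> C by rewrite invr_eq0 pnatr_eq0.
  move=> /(mulIf half_neq0)/(addrI _)/(addrI _)/oppr_inj/eqP.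
  by rewrite eqr_nat => /eqP/double_inj eq_ij; apply: val_inj.
have dualE (j : 'I_D.+1) (i : 'I_n) :
    dual_idem C D x j *m vsval (w i) = (k i == j)%:R *: vsval (w i).
  apply/matrixP => a b; rewrite ord1 mul_diag_mx !mxE hdistE //.
  have [->|wa] := eqVneq (vsval (w i) a 0) 0; first by rewrite !mulr0.
  by rewrite -[hamm _ _]/(h a) ((kP i).2 a wa).
have n_gt0 : (0 < n)%N by have := dim_W_gt0 W_irr; rewrite dim_subvs.
rewrite /Tmodule_diameter.
suff -> : [set j : 'I_D.+1 | (lmul_end (dual_idem C D x j) @: W)%VS != 0%VS] =
    [set k i | i : 'I_n].
  by rewrite card_imset // card_ord subn1.
apply/setP => j; rewrite inE; apply/idP/imsetP => [|[i _ ->]].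
  have [/existsP[i /eqP ki] _|no_i] := boolP [exists i : 'I_n, k i == j].
    by exists i.
  rewrite -subv0 => /subvP[]; move=> _ /memv_imgP[v Wv ->].
  rewrite lfunE /= memv0.
  (* When no [w i] sits on level [j], E*_j kills the basis and hence every [v] in [W]. *)
  pose c i := coord (map_tuple w (iota_tuple n 0)) i (vsproj W v).
  have -> : v = \sum_i c i *: vsval (w i).
    rewrite -[LHS](vsprojK Wv).
    rewrite (coord_basis (X := map_tuple w (iota_tuple n 0)) w_basis (memvf (vsproj W v))).
    rewrite linear_sum; apply: eq_bigr => i _.
    by rewrite linearZ; congr (_ *: vsval _); rewrite nth_mkseq.
  rewrite mulmx_sumr big1 // => i _; rewrite -scalemxAr dualE.
  by move: no_i; rewrite negb_exists => /forallP/(_ i)/negPf ->; rewrite scale0r scaler0.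
have := w_neq0 i (ltn_ord i); apply: contra_neq => img0.
have := memv_img (lmul_end (dual_idem C D x (k i))) (subvsP (w i)).
by rewrite img0 lfunE /= dualE // eqxx scale1r memv0 => /eqP.
Qed.

End Spectrum.

(** Equal powers of [1 - n] have equal squares, which are powers of a base above 1; for [n = 2] the
    base would be [- 1]. The comparison takes place in the ordered field [rat]. *)
Lemma exprz_1Bn_inj (F : numFieldType) (n : nat) :
  (2 < n)%N -> injective (fun m : int => (1 - n%:R : F) ^ m).
Proof.
move=> n_gt2 m m'; pose b : rat := 1 - n%:R.
have ratrE k : (1 - n%:R : F) ^ k = ratr (b ^ k).
  by rewrite fmorphXz rmorphB rmorph1 rmorph_nat.
rewrite !ratrE => /fmorph_inj eq_pow.
have sqr_gt1 : 1 < b ^+ 2.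
  have n_ge : 3 <= n%:R :> rat by rewrite ler_nat.
  by rewrite /b; nra.
apply: (ieexprIz (lt_trans ltr01 sqr_gt1)); first by rewrite gt_eqF.
by rewrite !exprnP !exprz_exp ![Posz 2 * _]mulrC -!exprz_exp eq_pow.
Qed.

Theorem corollary37 (R : realType) (D r : nat) (X : finType) (x : X)
    (W : {vspace hvector R[i] D X}) (d : nat) :
  (1 <= D)%N -> (3 <= r)%N -> #|X| = r ->
  irreducible_Tmodule x W ->
  Tmodule_diameter x W = d ->
  let f := action_on W (D_commutator R[i] D x) in
  [/\ diagonalizable_end f,
      forall a : R[i],
        passmx.leigenvalue f a <->
        exists s : int,
          [/\ - d%:Z <= s, s <= d%:Z, (2 %| d%:Z - s)%Z
            & a = (1 - r%:R) ^ s]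
    & forall a : R[i], passmx.leigenvalue f a -> \dim (passmx.leigenspace f a) = 1%N].
Proof.
move=> D_gt0 X_gt2 Xr W_irr dE f; rewrite -Xr in X_gt2 *; clear r Xr.
set r : R[i] := #|X|%:R.
have [w [w_basis wK]] := cartan_weight_basis D_gt0 X_gt2 W_irr.
have dimW : \dim W = d.+1.
  rewrite -dE (diameter_dim D_gt0 X_gt2 W_irr) prednK //.
  by have := dim_W_gt0 W_irr; rewrite dim_subvs.
rewrite dimW /= in w_basis wK.
pose s i : int := d%:Z - i.*2%:Z.
have fw i : (i < d.+1)%N -> f (w i) = (1 - r) ^ s i *: w i.
  move=> lt_id; apply: subvs_inj; rewrite linearZ /=.
  have stable : D_commutator R[i] D x *m vsval (w i) = (1 - r) ^ s i *: vsval (w i).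
    apply: (D_commutator_eigenvector X_gt2); rewrite wK // /s rmorphB.
    by [].
  by rewrite /f lfunE /= lfunE /= stable vsprojK // memvZ // subvsP.
have lam_inj (m m' : int) : m != m' -> (1 - r) ^ m != (1 - r) ^ m'.
  by apply: contra_neq; apply: exprz_1Bn_inj.
have lam_neq i j : (j < d.+1)%N -> (i < j)%N -> (1 - r) ^ s i != (1 - r) ^ s j.
  by move=> _ lt_ij; apply: lam_inj; rewrite /s; lia.
have [diag eig dim1] := eigenbasis_leigenspace w_basis fw lam_neq.
split=> // a; rewrite eig; split=> [[k lt_kd ->]|[m [ge_m le_m /dvdzP[q qE] ->]]].
  exists (s k); rewrite /s; split=> //; [lia|lia|].
  by apply/dvdzP; exists k%:Z; lia.
(* [q] is half of [d - m], and the bounds on [m] place it between 0 and [d]. *)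
by exists `|q|%N; [lia|congr (_ ^ _); rewrite /s; lia].
Qed.
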